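(* The Hermitian Jordan triple system $H_3(\mathbb{O})$ is simple and of tube type. Its numerical invariants are $a=8$, $b=0$, $r=3$, $g=18$.
   Context: $\mathbb{O}_c$ is the real 8-dimensional division algebra of octonions with positive definite multiplicative norm $n$, Cayley conjugation $a\mapsto\widetilde a$ ($a\widetilde a=n(a)1$), and bilinear form $(a:b)=n(a+b)-n(a)-n(b)$ (so $(a:a)=2n(a)$). $\mathbb{O}=\mathbb{C}\otimes_{\mathbb{R}}\mathbb{O}_c$ is the complex octonion algebra; product, $n$, $\widetilde{\ }$ and $(\,:\,)$ are extended complex (multi)linearly/quadratically, and $a\mapsto\overline a$ is complex conjugation with respect to $\mathbb{O}_c$. $H_3(\mathbb{O})$ is the 27-dimensional complex vector space of matrices $a=\begin{pmatrix}\alpha_1&a_3&\widetilde{a_2}\\ \widetilde{a_3}&\alpha_2&a_1\\ a_2&\widetilde{a_1}&\alpha_3\end{pmatrix}$, $\alpha_i\in\mathbb{C}$, $a_i\in\mathbb{O}$, written $a=\sum\alpha_ie_i+\sum F_i(a_i)$. Put $(a:b)=\sum\alpha_i\beta_i+\sum(a_i:b_i)$; $a^{\#}=\sum_i(\alpha_j\alpha_k-n(a_i))e_i+\sum_iF_i\bigl((a_ja_k)^{\sim}-\alpha_ia_i\bigr)$, where $(i,j,k)$ is the even (cyclic) permutation of $(1,2,3)$ starting with $i$; $a\times b=(a+b)^{\#}-a^{\#}-b^{\#}$; $\overline a=\sum\overline{\alpha_i}e_i+\sum F_i(\overline{a_i})$; $(a\mid b)=(a:\overline b)$. The triple product is $\{xyz\}=D(x,y)z=(x\mid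 y)z+(z\mid y)x-(x\times z)\times\overline y$; this makes $H_3(\mathbb{O})$ a positive Hermitian Jordan triple system (positive: $\{xxx\}=\lambda x$ with $x\neq0$ implies $\lambda>0$). General notions for a positive Hermitian Jordan triple system $V$. $V$ is simple if $V\ne0$ and the only complex subspaces $I$ with $\{IVV\}\subset I$ and $\{VIV\}\subset I$ are $0$ and $V$. A tripotent is $e$ with $\{eee\}=2e$; tripotents $e,f$ are orthogonal if $D(e,f)=0$; a nonzero tripotent is minimal if it is not a sum of two nonzero orthogonal tripotents. The Peirce spaces of $e$ are $V_j(e)=\{y:D(e,e)y=jy\}$, $j=0,1,2$. A frame is a maximal family $(c_1,\dots,c_r)$ of pairwise orthogonal minimal tripotents; its cardinality $r$ is the rank of $V$. The simultaneous Peirce spaces of a frame are $V_{ij}=\{y: D(c_k,c_k)y=(\delta_{ik}+\delta_{jk})y,\ 1\le k\le r\}$ for $0\le i\le j\le r$. If $V$ is simple, the numbers $a=\dim_{\mathbb{C}}V_{ij}$ ($1\le i<j\le r$) and $b=\dim_{\mathbb{C}}V_{0i}$ ($1\le i\le r$) do not depend on $i,j$ or on the frame; the genus is $g=2+a(r-1)+b$; $V$ is of tube type if $b=0$, equivalently $V_2(e)=V$ for maximal tripotents $e$ (those to which no nonzero tripotent is orthogonal). *)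

(* Defs.v *)
From HB Require Import structures.
From mathcomp Require Import all_boot all_order all_algebra.
From mathcomp Require Import reals.
From mathcomp Require Import complex.
From mathcomp Require Import ring.

Set Implicit Arguments.
Unset Strict Implicit.
Unset Printing Implicit Defensive.

Import Order.TTheory GRing.Theory Num.Theory.
Local Open Scope ring_scope.

(* A triple product {xyz} on V is given by the operators D(x,y) : z |-> {xyz}, *)
(* which are linear; the notions below use no other axiom.                    *)
Section TripleSystem.
Variables (F : fieldType) (V : vectType F) (D : V -> V -> 'End(V)).

Definition simple_system : Prop :=
  (fullv : {vspace V}) <> 0%VS /\
  forall I : {vspace V},
    (forall x y z, x \in I -> D x y z \in I) ->
    (forall x y z, y \in I -> D x y z \in I) ->
    I = 0%VS \/ I = fullv.

Definition tripotent (e : V) : Prop := D e e e = 2%:R *: e.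

Definition orthogonal (e f : V) : Prop := D e f = 0.

Definition minimal_tripotent (e : V) : Prop :=
  [/\ tripotent e, e <> 0 &
      ~ exists e1 e2 : V,
          [/\ tripotent e1, tripotent e2, e1 <> 0, e2 <> 0 &
              orthogonal e1 e2 /\ e = e1 + e2]].

Definition orthogonal_family (c : seq V) : Prop :=
  (forall e, e \in c -> minimal_tripotent e) /\
  (forall i j, (i < size c)%N -> (j < size c)%N -> i <> j ->
     orthogonal c`_i c`_j).

(* A nonzero tripotent is not orthogonal to itself, so such families have no  *)
(* repetition and maximality may be tested on the underlying sets.            *)
Definition frame (c : seq V) : Prop :=
  orthogonal_family c /\
  forall d, orthogonal_family d -> {subset c <= d} -> {subset d <= c}.

(* Indices i, j range over 0, ..., r with r = size c and the members of the   *)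
(* frame are numbered from 1, so that c_(k+1) is c`_k.                        *)
Definition peirce (c : seq V) (i j : nat) : {vspace V} :=
  (\bigcap_(k < size c)
     passmx.leigenspace (D c`_k c`_k) ((i == k.+1) + (j == k.+1))%:R)%VS.

(* The numerical invariants are relations: the value must be the same for all *)
(* frames (and all indices), and there must be at least one frame.            *)
Definition is_rank (r : nat) : Prop :=
  (exists c, frame c) /\ forall c, frame c -> size c = r.

Definition is_inv_a (a : nat) : Prop :=
  (exists c, frame c) /\
  forall c, frame c ->
    forall i j, (1 <= i)%N -> (i < j)%N -> (j <= size c)%N ->
      \dim (peirce c i j) = a.

Definition is_inv_b (b : nat) : Prop :=
  (exists c, frame c) /\
  forall c, frame c ->
    forall i, (1 <= i)%N -> (i <= size c)%N -> \dim (peirce c 0 i) = b.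

Definition is_genus (g : nat) : Prop :=
  exists a b r : nat,
    [/\ is_inv_a a, is_inv_b b, is_rank r & g = (2 + a * (r - 1) + b)%N].

Definition tube_type : Prop := is_inv_b 0.

End TripleSystem.

(* Octonions x_0 + \sum_m x_m e_m with m in 'I_7 = Z/7 are stored as          *)
(* (x_0, (x_m)_m).  The multiplication table is e_m ^ 2 = -1 and              *)
(* e_m e_(m+1) = e_(m+3) together with its cyclic and opposite versions, so   *)
(* e_m = e_(m+1) e_(m+3) = e_(m+2) e_(m+6) = e_(m+4) e_(m+5).  The structure  *)
(* constants are integers: for K = R this is the division algebra O_c         *)
(* (see onormM, onorm_gt0), and for K = R[i] its complexification.            *)
Section Octonions.
Variable K : fieldType.

Definition oct : vectType K := (K^o * 'rV[K]_7)%type.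

Definition ore (x : oct) : K := x.1.
Definition oim (x : oct) (m : 'I_7) : K := x.2 0 m.

Definition oscal (k : K) : oct := (k : K^o, 0).

Definition omul (x y : oct) : oct :=
  ((ore x * ore y - \sum_m oim x m * oim y m : K^o),
   \row_m (ore x * oim y m + oim x m * ore y
           + (oim x (m + 1) * oim y (m + 3%:R)
              - oim x (m + 3%:R) * oim y (m + 1))
           + (oim x (m + 2%:R) * oim y (m + 6%:R)
              - oim x (m + 6%:R) * oim y (m + 2%:R))
           + (oim x (m + 4%:R) * oim y (m + 5%:R)
              - oim x (m + 5%:R) * oim y (m + 4%:R)))).

Definition oconj (x : oct) : oct := (ore x : K^o, - x.2).

Definition onorm (x : oct) : K := ore x ^+ 2 + \sum_m oim x m ^+ 2.

Definition oform (x y : oct) : K := onorm (x + y) - onorm x - onorm y.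

Definition omap (f : K -> K) (x : oct) : oct := (f (ore x) : K^o, map_mx f x.2).

Lemma oct_eq (x y : oct) : ore x = ore y -> oim x =1 oim y -> x = y.
Proof.
case: x y => [x0 x] [y0 y]; rewrite /ore /oim /= => -> eq_xy.
by congr pair; apply/rowP.
Qed.

Lemma oreD x y : ore (x + y) = ore x + ore y. Proof. by []. Qed.
Lemma oreN x : ore (- x) = - ore x. Proof. by []. Qed.
Lemma oreZ k x : ore (k *: x) = k * ore x. Proof. by []. Qed.
Lemma oimD x y m : oim (x + y) m = oim x m + oim y m. Proof. exact: mxE. Qed.
Lemma oimN x m : oim (- x) m = - oim x m. Proof. exact: mxE. Qed.
Lemma oimZ k x m : oim (k *: x) m = k * oim x m. Proof. exact: mxE. Qed.

Definition octE := (oreD, oreN, oreZ, oimD, oimN, oimZ).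

Lemma ore_mul x y :
  ore (omul x y) = ore x * ore y - \sum_m oim x m * oim y m.
Proof. by []. Qed.

Lemma oim_mul x y m : oim (omul x y) m =
  ore x * oim y m + oim x m * ore y
  + (oim x (m + 1) * oim y (m + 3%:R) - oim x (m + 3%:R) * oim y (m + 1))
  + (oim x (m + 2%:R) * oim y (m + 6%:R) - oim x (m + 6%:R) * oim y (m + 2%:R))
  + (oim x (m + 4%:R) * oim y (m + 5%:R) - oim x (m + 5%:R) * oim y (m + 4%:R)).
Proof. exact: mxE. Qed.

Lemma ore_conj x : ore (oconj x) = ore x. Proof. by []. Qed.
Lemma oim_conj x m : oim (oconj x) m = - oim x m. Proof. exact: mxE. Qed.

Lemma omul_linearl y : linear (omul^~ y).
Proof.
move=> k a b; apply: oct_eq => [|m].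
  rewrite !(octE, ore_mul) mulrBr mulr_sumr mulrDl -mulrA.
  rewrite addrACA -opprD -big_split /=; congr (_ - _); apply: eq_bigr => m _.
  by rewrite !octE; ring.
by rewrite !(octE, oim_mul); ring.
Qed.

Lemma omul_linearr x : linear (omul x).
Proof.
move=> k a b; apply: oct_eq => [|m].
  rewrite !(octE, ore_mul) mulrBr mulr_sumr mulrDr mulrCA.
  rewrite addrACA -opprD -big_split /=; congr (_ - _); apply: eq_bigr => m _.
  by rewrite !octE; ring.
by rewrite !(octE, oim_mul); ring.
Qed.

Lemma oconj_linear : linear oconj.
Proof.
move=> k a b; apply: oct_eq => [|m]; first by rewrite !(octE, ore_conj).
by rewrite !(octE, oim_conj) opprD mulrN.
Qed.

Lemma oconjK : involutive oconj.
Proof. by move=> x; apply: oct_eq => // m; rewrite !oim_conj opprK. Qed.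

Lemma oformE x y :
  oform x y = 2%:R * (ore x * ore y + \sum_m oim x m * oim y m).
Proof.
rewrite /oform /onorm oreD.
have -> : \sum_m oim (x + y) m ^+ 2 = \sum_m oim x m ^+ 2
    + 2%:R * (\sum_m oim x m * oim y m) + \sum_m oim y m ^+ 2.
  rewrite mulr_sumr -!big_split /=; apply: eq_bigr => m _.
  by rewrite oimD; ring.
by ring.
Qed.

Lemma oformC x y : oform x y = oform y x.
Proof. by rewrite /oform [y + x]addrC addrAC. Qed.

Lemma oformPl k x y z : oform (k *: x + y) z = k * oform x z + oform y z.
Proof.
rewrite !oformE oreD oreZ.
have -> : \sum_m oim (k *: x + y) m * oim z m =
    k * (\sum_m oim x m * oim z m) + \sum_m oim y m * oim z m.
  by rewrite mulr_sumr -big_split /=; apply: eq_bigr => m _; rewrite !octE; ring.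
by ring.
Qed.

Lemma omul_conj x : omul x (oconj x) = oscal (onorm x).
Proof.
apply: oct_eq => [|m].
  rewrite ore_mul /oscal /onorm /ore /= -expr2; congr (_ + _).
  by rewrite -sumrN; apply: eq_bigr => m _; rewrite oim_conj mulrN opprK.
rewrite oim_mul !oim_conj ore_conj /oscal /oim /= mxE; ring.
Qed.

Lemma onormM x y : onorm (omul x y) = onorm x * onorm y.
Proof.
pose u (i : nat) := oim x (inZp i); pose v (i : nat) := oim y (inZp i).
have uE m : oim x m = u m by rewrite /u valZpK.
have vE m : oim y m = v m by rewrite /v valZpK.
rewrite /onorm ore_mul !big_ord_recl !big_ord0 !oim_mul !(uE, vE).
move: u v {uE vE} (ore x) (ore y) => u v x0 y0.
repeat match goal with
 | |- context [u (nat_of_ord ?i)] =>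
   let n := eval vm_compute in (nat_of_ord i) in change (u (nat_of_ord i)) with (u n)
 | |- context [v (nat_of_ord ?i)] =>
   let n := eval vm_compute in (nat_of_ord i) in change (v (nat_of_ord i)) with (v n)
end.
ring.
Qed.
End Octonions.

Lemma onorm_gt0 (R : realFieldType) (x : oct R) : x != 0 -> 0 < onorm x.
Proof.
move=> x_neq0; rewrite lt_def; apply/andP; split; last first.
  by rewrite addr_ge0 ?sqr_ge0 ?sumr_ge0 // => m _; rewrite sqr_ge0.
apply: contraNneq x_neq0 => /eqP.
rewrite paddr_eq0 ?sqr_ge0 ?sumr_ge0 // => [|m _]; last by rewrite sqr_ge0.
rewrite sqrf_eq0 psumr_eq0 => [/andP[/eqP x0 /allP xm]|m _]; last first.
  by rewrite sqr_ge0.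
apply/eqP/oct_eq => [|m]; first exact: x0.
by have := xm m (mem_index_enum _); rewrite /= sqrf_eq0 => /eqP ->; rewrite /oim mxE.
Qed.

(* The Hermitian 3 x 3 matrix a = \sum_i alpha_i e_i + \sum_i F_i(a_i) is     *)
(* stored as (alpha, (a_i)_i), see H3_mx.  The indices 1, 2, 3 are            *)
(* 0, 1, 2 : 'I_3; since 'I_3 is Z/3, the cyclic permutation starting with i  *)
(* is (i, i + 1, i + 2).                                                      *)
Section Hermitian.
Variable K : fieldType.

Definition H3 : vectType K :=
  ({ffun 'I_3 -> K^o} * {ffun 'I_3 -> oct K})%type.

Definition hdiag (a : H3) (i : 'I_3) : K := a.1 i.
Definition hoff (a : H3) (i : 'I_3) : oct K := a.2 i.

Definition H3_mx (a : H3) : 'M[oct K]_3 :=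
  \matrix_(i, j)
    if i == j then oscal (hdiag a i)
    else if j == i + 1 then hoff a (i + 2%:R) else oconj (hoff a (j + 2%:R)).

Definition H3_form (a b : H3) : K :=
  \sum_i hdiag a i * hdiag b i + \sum_i oform (hoff a i) (hoff b i).

Definition H3_sharp (a : H3) : H3 :=
  ([ffun i => hdiag a (i + 1) * hdiag a (i + 2%:R) - onorm (hoff a i) : K^o],
   [ffun i => oconj (omul (hoff a (i + 1)) (hoff a (i + 2%:R)))
              - hdiag a i *: hoff a i]).

Definition H3_cross (a b : H3) : H3 :=
  H3_sharp (a + b) - H3_sharp a - H3_sharp b.

Definition H3_map (f : K -> K) (a : H3) : H3 :=
  ([ffun i => f (hdiag a i) : K^o], [ffun i => omap f (hoff a i)]).

Lemma H3_eq (a b : H3) : hdiag a =1 hdiag b -> hoff a =1 hoff b -> a = b.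
Proof.
by case: a b => [al a] [be b] eq1 eq2; congr pair; apply/ffunP.
Qed.

Lemma hdiagD a b i : hdiag (a + b) i = hdiag a i + hdiag b i.
Proof. exact: ffunE. Qed.
Lemma hdiagN a i : hdiag (- a) i = - hdiag a i. Proof. exact: ffunE. Qed.
Lemma hdiagZ k a i : hdiag (k *: a) i = k * hdiag a i. Proof. exact: ffunE. Qed.
Lemma hoffD a b i : hoff (a + b) i = hoff a i + hoff b i.
Proof. exact: ffunE. Qed.
Lemma hoffN a i : hoff (- a) i = - hoff a i. Proof. exact: ffunE. Qed.
Lemma hoffZ k a i : hoff (k *: a) i = k *: hoff a i. Proof. exact: ffunE. Qed.

Definition H3E := (hdiagD, hdiagN, hdiagZ, hoffD, hoffN, hoffZ).

Lemma hdiag_sharp a i : hdiag (H3_sharp a) i =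
  hdiag a (i + 1) * hdiag a (i + 2%:R) - onorm (hoff a i).
Proof. exact: ffunE. Qed.

Lemma hoff_sharp a i : hoff (H3_sharp a) i =
  oconj (omul (hoff a (i + 1)) (hoff a (i + 2%:R))) - hdiag a i *: hoff a i.
Proof. exact: ffunE. Qed.

(* H3 parametrizes exactly the matrices equal to their conjugate transpose;   *)
(* outside characteristic 2 the diagonal entries of those are scalar.         *)
Lemma H3_mx_inj : injective H3_mx.
Proof.
move=> a b /matrixP eq_ab; apply: H3_eq => i.
  by have := eq_ab i i; rewrite !mxE eqxx => -[].
have := eq_ab (i + 1) (i + 2%:R); rewrite !mxE.
have -> : i + 2%:R = i + 1 + 1 :> 'I_3 by rewrite -addrA.
have -> : i + 1 + 2%:R = i :> 'I_3.
  by rewrite -addrA; apply: val_inj; case: i => [[|[|[|]]]].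
by rewrite eqxx; case: eqP => // /eqP; case: i => [[|[|[|]]]].
Qed.

Lemma H3_mxP (M : 'M[oct K]_3) : 2%:R != 0 :> K ->
  (exists a, M = H3_mx a) <-> (forall i j, M i j = oconj (M j i)).
Proof.
move=> two_neq0; have next_neq (i j : 'I_3) :
    i != j -> (j == i + 1) = ~~ (i == j + 1).
  by case: i => -[|[|[|//]]] ?; case: j => -[|[|[|//]]] ?.
have prevE (i : 'I_3) : i + 1 + 1 = i + 2%:R by rewrite -addrA.
have nextE (i : 'I_3) : i + 2%:R + 1 = i.
  by rewrite -addrA; apply: val_inj; case: i => [[|[|[|]]]].
split=> [[a ->] i j | hermM].
  rewrite !mxE; have [->|neq_ij] := eqVneq i j.
    by apply: oct_eq => // m; rewrite oim_conj /oim /oscal mxE oppr0.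
  rewrite next_neq //; case: (i == j + 1) => //=.
  by rewrite oconjK.
exists ([ffun i => ore (M i i) : K^o], [ffun i => M (i + 1) (i + 2%:R)]).
apply/matrixP=> i j; rewrite mxE /hdiag /hoff !ffunE.
have [<-|neq_ij] := eqVneq i j.
  apply: oct_eq => // m; rewrite [RHS]mxE; apply/eqP.
  rewrite -(mulrI_eq0 _ (mulfI two_neq0)) mulr_natl mulr2n addr_eq0.
  by rewrite -oim_conj -hermM.
rewrite next_neq //; have [->|] /= := eqVneq i (j + 1).
  by rewrite hermM -[j + 2%:R + 2%:R]prevE !nextE.
move=> neq_i; have := next_neq i j neq_ij; rewrite neq_i => /eqP ->.
by rewrite -[i + 2%:R + 2%:R]prevE !nextE.
Qed.

Lemma hdiag_cross a b i : hdiag (H3_cross a b) i =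
  hdiag a (i + 1) * hdiag b (i + 2%:R) + hdiag b (i + 1) * hdiag a (i + 2%:R)
  - oform (hoff a i) (hoff b i).
Proof. by rewrite /H3_cross !(H3E, hdiag_sharp) /oform; ring. Qed.

Lemma hoff_cross a b i : hoff (H3_cross a b) i =
  oconj (omul (hoff a (i + 1)) (hoff b (i + 2%:R)))
  + oconj (omul (hoff b (i + 1)) (hoff a (i + 2%:R)))
  - hdiag a i *: hoff b i - hdiag b i *: hoff a i.
Proof.
rewrite /H3_cross !(H3E, hoff_sharp).
have oconjD x y : oconj (x + y) = oconj x + oconj y.
  by have := oconj_linear 1 x y; rewrite !scale1r.
have omulDl x y z : omul (x + y) z = omul x z + omul y z.
  by have := omul_linearl z 1 x y; rewrite !scale1r.
have omulDr x y z : omul z (x + y) = omul z x + omul z y.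
  by have := omul_linearr z 1 x y; rewrite !scale1r.
rewrite omulDl !omulDr !oconjD.
move: (oconj _) (oconj _) (oconj _) (oconj _) => x1 x2 x3 x4.
by apply: oct_eq => [|m]; rewrite !octE; ring.
Qed.

Let polar_sym (U W : zmodType) (f : U -> W) a b :
  f (a + b) - f a - f b = f (b + a) - f b - f a.
Proof. by rewrite [b + a]addrC addrAC. Qed.

Lemma H3_crossC a b : H3_cross a b = H3_cross b a.
Proof. exact: polar_sym. Qed.

Lemma H3_cross_linearr a : linear (H3_cross a).
Proof.
move=> k b c; refine (H3_eq _ _) => i.
  rewrite [RHS]hdiagD [X in _ = X + _]hdiagZ [X in _ = _ * X + _]hdiag_cross.
  rewrite [X in _ = _ + X]hdiag_cross [LHS]hdiag_cross.
  rewrite !(hdiagD (k *: b)) !hdiagZ hoffD hoffZ.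
  by rewrite !(oformC (hoff a i)) oformPl; ring.
rewrite [RHS]hoffD [X in _ = X + _]hoffZ [X in _ = _ *: X + _]hoff_cross.
rewrite [X in _ = _ + X]hoff_cross [LHS]hoff_cross.
rewrite !(hoffD (k *: b)) !hoffZ hdiagD hdiagZ.
rewrite omul_linearl omul_linearr !oconj_linear.
move: (oconj _) (oconj _) (oconj _) (oconj _) => x1 x2 x3 x4.
by apply: oct_eq => [|m]; rewrite !octE; ring.
Qed.

Lemma H3_formPl k a b c :
  H3_form (k *: a + b) c = k * H3_form a c + H3_form b c.
Proof.
rewrite /H3_form mulrDr addrACA !mulr_sumr.
congr (_ + _); rewrite -big_split /=; apply: eq_bigr => i _.
  by rewrite !H3E; ring.
by rewrite !H3E oformPl.
Qed.
End Hermitian.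

Section HermitianTriple.
Variable R : realType.
Local Notation V := (H3 R[i]).

(* Complex conjugation with respect to the real form H3 R.                    *)
Definition H3_bar : V -> V := H3_map (@conjc R).

Definition H3_herm (x y : V) : R[i] := H3_form x (H3_bar y).

Definition H3_triple (x y z : V) : V :=
  H3_herm x y *: z + H3_herm z y *: x - H3_cross (H3_cross x z) (H3_bar y).

Definition H3_D (x y : V) : 'End(V) := linfun (H3_triple x y).

Let triple_linear (W : lmodType R[i]) (herm : W -> W -> R[i])
    (cross : W -> W -> W) (x y y' : W) :
  (forall k a b c, herm (k *: a + b) c = k * herm a c + herm b c) ->
  (forall a, linear (cross a)) -> (forall a b, cross a b = cross b a) ->
  linear (fun z => herm x y *: z + herm z y *: x - cross (cross x z) y').
Proof.
move=> herm_lin cross_lin crossC k a b; rewrite cross_lin herm_lin.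
rewrite !(crossC _ y') cross_lin scalerDr scalerDl opprD.
rewrite [X in X + _ = _]addrACA [LHS]addrACA; congr (_ + _).
by rewrite !scalerDr scalerN !scalerA [_ * k]mulrC.
Qed.

Lemma H3_triple_linear (x y : V) : linear (H3_triple x y).
Proof.
apply: triple_linear; last exact: H3_crossC; last exact: H3_cross_linearr.
by move=> k a b c; exact: H3_formPl.
Qed.

Lemma H3_DE (x y z : V) : H3_D x y z = H3_triple x y z.
Proof.
pose L := GRing.isLinear.Build R[i] V V _ (H3_triple x y) (H3_triple_linear x y).
pose f : {linear V -> V} := HB.pack (H3_triple x y) L.
exact: (lfunE f).
Qed.
End HermitianTriple.

(* Main.v *)
From HB Require Import structures.
From mathcomp Require Import all_boot all_order all_algebra.
From mathcomp Require Import reals complex.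
From mathcomp Require Import ring zify.
Require Import Defs.

Set Implicit Arguments.
Unset Strict Implicit.
Unset Printing Implicit Defensive.

Import Order.TTheory GRing.Theory Num.Theory.
Local Open Scope ring_scope.

(* An element [x] of H_3(O) is of rank one when [x^# = 0].  The rank-one elements
   of norm 1 turn out to be exactly the minimal tripotents.  If [e] is such an
   element, [D(e,e)^2 = D(e,e) + 2 P_e] with [P_e] the orthogonal projection on
   [e], so that [V_2(e)] is a line and [e] is minimal.  Conversely a tripotent
   with [e^# <> 0] is split by solving a quadratic equation only: if [N e = 0]
   it lies in a spin factor, where [e = (e + u) / 2 + (e - u) / 2] for a suitable
   [u] orthogonal to [e]; if [N e <> 0], the antilinear Peirce involution
   [sg = Q(e)] has a rank-one fixed point, obtained from [x = v + sg v] with [v] of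
   rank one, because [N x = 0] and hence [(x^#)^# = 0].

   If [c1, c2] are orthogonal of rank one, then so is [c3 = bar (c1 x c2)], and the
   polarized adjoint identity [(x^#)^# = N(x) x] is literally
   [D(c1,c1) + D(c2,c2) + D(c3,c3) = 2].  Hence every frame has three elements and
   [b = 0].  The operator [D(ci,ci) D(cj,cj)] is the projection on [V_ij], and its
   dimension follows from the trace formula [tr D(x,y) = 18 (x | y)]. *)

(** * Traces of endomorphisms *)

Section EndTrace.
Import VectorInternalTheory.
Variables (K : fieldType) (V : vectType K).
Implicit Types f g : 'End(V).

Definition lfun_trace f : K := \tr (f2mx f).

Lemma v2r_lfun f v : v2r (f v) = v2r v *m f2mx f.
Proof. by rewrite unlock /= r2vK. Qed.

Lemma f2mx_eq f (A : 'M_(dim V)) :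
  (forall v, v2r (f v) = v2r v *m A) -> f2mx f = A.
Proof.
move=> fA; apply/row_matrixP => i; rewrite !rowE.
by have := fA (r2v (delta_mx 0 i)); rewrite v2r_lfun r2vK.
Qed.

Lemma f2mx_comp f g : f2mx (f \o g)%VF = f2mx g *m f2mx f.
Proof. by apply: f2mx_eq => v; rewrite comp_lfunE !v2r_lfun mulmxA. Qed.

Lemma lfun_traceD f g : lfun_trace (f + g) = lfun_trace f + lfun_trace g.
Proof.
rewrite /lfun_trace -mxtraceD; congr (\tr _); apply: f2mx_eq => v.
by rewrite lfunE /= linearD /= !v2r_lfun mulmxDr.
Qed.

Lemma lfun_traceZ k f : lfun_trace (k *: f) = k * lfun_trace f.
Proof.
rewrite /lfun_trace -mxtraceZ; congr (\tr _); apply: f2mx_eq => v.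
by rewrite lfunE /= linearZ /= !v2r_lfun scalemxAr.
Qed.

Lemma scalar_colP (phi : V -> K) : scalar phi ->
  exists A : 'cV[K]_(dim V), forall z, v2r z *m A = (phi z)%:M.
Proof.
move=> lin; pose L := GRing.isLinear.Build K V K _ phi lin.
have [f fE] : exists f : {scalar V}, phi =1 f by exists (HB.pack phi L : {scalar V}).
exists (\col_i f (r2v (delta_mx 0 i))) => z; rewrite fE.
apply/matrixP => i j; rewrite !ord1 !mxE eqxx mulr1n.
rewrite -{2}(v2rK z) [X in r2v X]row_sum_delta !linear_sum /=.
by apply: eq_bigr => k _; rewrite mxE !linearZ.
Qed.

(** The coordinates [phi i] write the matrix of [f] as a sum of columns times the rows of [f (b i)];
    swapping the two factors under the trace leaves scalars. *)
Lemma lfun_trace_basis (I : finType) (b : I -> V) (phi : I -> V -> K) f :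
  (forall i, scalar (phi i)) -> (forall z, z = \sum_i phi i z *: b i) ->
  lfun_trace f = \sum_i phi i (f (b i)).
Proof.
move=> lin zE; have [A phiA] := fin_all_exists (fun i => scalar_colP (lin i)).
have -> : lfun_trace f = \tr (\sum_i A i *m v2r (f (b i))).
  congr (\tr _); apply: f2mx_eq => z; rewrite {1}(zE z) !linear_sum.
  by apply: eq_bigr => i _; rewrite !linearZ /= mulmxA phiA mul_scalar_mx.
rewrite linear_sum; apply: eq_bigr => i _.
by rewrite /= mxtrace_mulC phiA mxtrace_scalar mulr1n.
Qed.

Lemma lfun_trace_line f (phi : V -> K) v : scalar phi ->
  (forall z, f z = phi z *: v) -> lfun_trace f = phi v.
Proof.
move=> lin fE; have [A phiA] := scalar_colP lin.
have -> : lfun_trace f = \tr (A *m v2r v).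
  congr (\tr _); apply: f2mx_eq => z.
  by rewrite fE linearZ /= mulmxA phiA mul_scalar_mx.
by rewrite mxtrace_mulC phiA mxtrace_scalar mulr1n.
Qed.

Lemma lfun_trace_idem f : (f \o f)%VF = f -> lfun_trace f = (\dim (limg f))%:R.
Proof.
move=> ff.
have -> : \dim (limg f) = \rank (f2mx f).
  rewrite unlock /dimv mx2vsK.
  by rewrite /fullv /= genmx1 mul1mx.
have := f2mx_comp f f; rewrite ff /lfun_trace; move: (f2mx f) => A AA.
(* Full-rank factorization [A = B C]: idempotence reads [B (C B) C = B C], and cancelling [B] and
   [C] leaves [C B = 1], an identity matrix whose size is the rank. *)
have : col_base A *m (row_base A *m col_base A) *m row_base A 
    = col_base A *m 1%:M *m row_base A.
  by rewrite mulmx1 mulmx_base mulmxA mulmx_base -mulmxA mulmx_base.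
move/(row_free_inj (row_base_free A)).
move/(row_full_inj (col_base_full A)) => rc.
by rewrite -{1}(mulmx_base A) mxtrace_mulC rc mxtrace1.
Qed.

End EndTrace.

(** * Polarization of symmetric quadrilinear forms *)

Lemma quadrilinear_diag0 (K : numFieldType) (U : lmodType K)
    (S : U -> U -> U -> U -> K) :
  (forall k x y b c d, S (k *: x + y) b c d = k * S x b c d + S y b c d) ->
  (forall a b c d, S a b c d = S b a c d) ->
  (forall a b c d, S a b c d = S a c b d) ->
  (forall a b c d, S a b c d = S a b d c) ->
  (forall x, S x x x x = 0) -> forall a b c d, S a b c d = 0.
Proof.
move=> l1 s12 s23 s34 S0.
have l2 k x y a c d : S a (k *: x + y) c d = k * S a x c d + S a y c d.
  by rewrite !(s12 a) l1.
have l3 k x y a b d : S a b (k *: x + y) d = k * S a b x d + S a b y d.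
  by rewrite !(s23 a b) l2.
have l4 k x y a b c : S a b c (k *: x + y) = k * S a b c x + S a b c y.
  by rewrite !(s34 a b c) l3.
have S3 x y : S x x x y = 0.
  pose E k := 4%:R * k * S x x x y + 6%:R * k ^+ 2 * S x x y y + 4%:R * k ^+ 3 * S x y y y.
  have e k : E k = 0.
    have := S0 (k *: y + x); rewrite !(l1, l2, l3, l4).
    by rewrite !(s12 y x, s23 _ y x, s34 _ _ y x) !S0 => <-; rewrite /E; ring.
  (* These weights at the parameters 1, -1, 2 keep the coefficient of [k] and kill those of [k ^+ 2]
     and [k ^+ 3]. *)
  transitivity (4%:R^-1 * E 1 - 12%:R^-1 * E (- 1) - 24%:R^-1 * E 2%:R).
    by rewrite /E; field.
  by rewrite !e; ring.
have S2 x y z : S x x z y = 0.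
  pose E k := 3%:R * k * S x x z y + 3%:R * k ^+ 2 * S x z z y.
  have e k : E k = 0.
    have := S3 (k *: z + x) y; rewrite !(l1, l2, l3).
    by rewrite !(s12 z x, s23 _ z x) !S3 => <-; rewrite /E; ring.
  transitivity (6%:R^-1 * E 1 - 6%:R^-1 * E (- 1)); first by rewrite /E; field.
  by rewrite !e; ring.
move=> a b c d; have := S2 (1 *: a + b) d c; rewrite !(l1, l2) !S2 (s12 b a) => h.
transitivity (2%:R^-1 * (1 * (1 * 0 + S a b c d) + (1 * S a b c d + 0))).
  by field.
by rewrite h mulr0.
Qed.

(* [cross x y] is the polarization of [x^#] = [cross x x / 2], and the cubic norm is
   [N x = (x^# : x) / 3]; [hc_sharp_sharp] is the identity [(x^#)^# = N(x) x]. *)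
Record hermitian_cubic (C : numClosedFieldType) (V : vectType C)
    (cross : V -> V -> V) (form : V -> V -> C) (bar : V -> V)
    (D : V -> V -> 'End(V)) : Prop := HermitianCubic {
  hc_formC : forall x y, form x y = form y x;
  hc_formP : forall k x y z, form (k *: x + y) z = k * form x z + form y z;
  hc_crossC : forall x y, cross x y = cross y x;
  hc_crossP : forall k x y z,
    cross (k *: x + y) z = k *: cross x z + cross y z;
  hc_form_cross : forall x y z, form (cross x y) z = form x (cross y z);
  hc_sharp_sharp : forall x, cross (cross x x) (cross x x)
    = (4%:R / 3%:R * form (cross x x) x) *: x;
  hc_barK : involutive bar;
  hc_barP : forall k x y, bar (k *: x + y) = k^* *: bar x + bar y;
  hc_bar_cross : forall x y, bar (cross x y) = cross (bar x) (bar y);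
  hc_form_bar : forall x y, form (bar x) (bar y) = (form x y)^*;
  hc_pos : forall x, x <> 0 -> 0 < form x (bar x);
  hc_D : forall x y z,
    D x y z = form x (bar y) *: z + form z (bar y) *: x
              - cross (cross x z) (bar y);
  hc_cross_rank1 : forall x, x <> 0 -> exists2 z, cross z z = 0 & cross x z <> 0;
  hc_nonzero : exists x : V, x <> 0;
  hc_trace : forall x y, lfun_trace (D x y) = 18%:R * form x (bar y)
}.

(** * Tripotents and frames of a Hermitian cubic form *)

Section HermitianCubic.
Variables (C : numClosedFieldType) (V : vectType C).
Variables (cross : V -> V -> V) (form : V -> V -> C) (bar : V -> V).
Variable D : V -> V -> 'End(V).
Hypothesis HC : hermitian_cubic cross form bar D.

Local Notation "x ** y" := (cross x y) (at level 40, left associativity).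
Local Notation "''[' x , y ]" := (form x (bar y)).

Let formC := hc_formC HC.
Let crossC := hc_crossC HC.
Let form_cross := hc_form_cross HC.
Let barK := hc_barK HC.
Let bar_cross := hc_bar_cross HC.
Let form_bar := hc_form_bar HC.
Let DE := hc_D HC.

(** * Linearity of the form, the cross product and the conjugation *)

Lemma formDl x y z : form (x + y) z = form x z + form y z.
Proof. by have := hc_formP HC 1 x y z; rewrite scale1r mul1r. Qed.
Lemma form0l z : form 0 z = 0.
Proof. by apply: (@addrI _ (form 0 z)); rewrite -formDl !addr0. Qed.
Lemma formZl k x z : form (k *: x) z = k * form x z.
Proof. by have := hc_formP HC k x 0 z; rewrite addr0 form0l addr0. Qed.
Lemma formNl x z : form (- x) z = - form x z.
Proof. by rewrite -scaleN1r formZl mulN1r. Qed.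
Lemma formDr x y z : form z (x + y) = form z x + form z y.
Proof. by rewrite !(formC z) formDl. Qed.
Lemma form0r z : form z 0 = 0.
Proof. by rewrite formC form0l. Qed.
Lemma formZr k x z : form z (k *: x) = k * form z x.
Proof. by rewrite !(formC z) formZl. Qed.
Lemma formNr x z : form z (- x) = - form z x.
Proof. by rewrite !(formC z) formNl. Qed.

Lemma crossDl x y z : (x + y) ** z = x ** z + y ** z.
Proof. by have := hc_crossP HC 1 x y z; rewrite !scale1r. Qed.
Lemma cross0l z : 0 ** z = 0.
Proof. by apply: (@addrI _ (0 ** z)); rewrite -crossDl !addr0. Qed.
Lemma crossZl k x z : (k *: x) ** z = k *: (x ** z).
Proof. by have := hc_crossP HC k x 0 z; rewrite addr0 cross0l addr0. Qed.
Lemma crossNl x z : (- x) ** z = - (x ** z).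
Proof. by rewrite -scaleN1r crossZl scaleN1r. Qed.
Lemma crossDr x y z : z ** (x + y) = z ** x + z ** y.
Proof. by rewrite !(crossC z) crossDl. Qed.
Lemma cross0r z : z ** 0 = 0.
Proof. by rewrite crossC cross0l. Qed.
Lemma crossZr k x z : z ** (k *: x) = k *: (z ** x).
Proof. by rewrite !(crossC z) crossZl. Qed.
Lemma crossNr x z : z ** (- x) = - (z ** x).
Proof. by rewrite !(crossC z) crossNl. Qed.

Lemma barD x y : bar (x + y) = bar x + bar y.
Proof. by have := hc_barP HC 1 x y; rewrite scale1r rmorph1 scale1r. Qed.
Lemma bar0 : bar 0 = 0.
Proof. by apply: (@addrI _ (bar 0)); rewrite -barD !addr0. Qed.
Lemma barZ k x : bar (k *: x) = k^* *: bar x.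
Proof. by have := hc_barP HC k x 0; rewrite addr0 bar0 addr0. Qed.
Lemma barN x : bar (- x) = - bar x.
Proof. by rewrite -scaleN1r barZ rmorphN1 scaleN1r. Qed.

Let linE := (formDl, formZl, formNl, form0l, formDr, formZr, formNr, form0r,
  crossDl, crossZl, crossNl, cross0l, crossDr, crossZr, crossNr, cross0r,
  barD, barZ, barN, bar0).

(* Nondegeneracy of the form turns identities between vectors into scalar ones. *)
Lemma form_inj x y : (forall w, form x w = form y w) -> x = y.
Proof.
move=> eq_xy; apply/eqP; rewrite -subr_eq0; apply/eqP.
case: (eqVneq (x - y) 0) => // /eqP /(hc_pos HC).
by rewrite formDl formNl eq_xy subrr ltxx.
Qed.

(** * Polarized adjoint identities *)

Local Ltac vec := apply: form_inj => ?; rewrite !linE; field; rewrite ?andbT ?pnatr_eq0 //.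

(** Full polarization of [hc_sharp_sharp]: the difference of both sides, paired with [w], is
    symmetric and quadrilinear, and on the diagonal it is [3 (x ** x) ** (x ** x) - 4 (x ** x : x)
    x] paired with [w]. *)
Lemma cross4 a b c d :
  (a ** b) ** (c ** d) + (a ** c) ** (b ** d) + (b ** c) ** (a ** d)
  = form (a ** b) c *: d + form (a ** b) d *: c
    + form (a ** c) d *: b + form (b ** c) d *: a.
Proof.
apply: form_inj => w; apply/eqP; rewrite -subr_eq0; apply/eqP.
pose S a b c d := form ((a ** b) ** (c ** d) + (a ** c) ** (b ** d)
  + (b ** c) ** (a ** d)) w - form (form (a ** b) c *: d + form (a ** b) d *: c
    + form (a ** c) d *: b + form (b ** c) d *: a) w.
rewrite -/(S a b c d); move: a b c d; apply: quadrilinear_diag0; rewrite /S {S}.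
- by move=> k x y b c d; rewrite !linE; ring.
- by move=> a b c d; rewrite (crossC b a) !linE; ring.
- move=> a b c d; rewrite (crossC c b) !linE.
  by rewrite (form_cross a c b) (form_cross a b c) (crossC c b); ring.
- move=> a b c d; rewrite (crossC d c) (crossC (b ** d)) (crossC (b ** c)) !linE.
  rewrite (form_cross a d c) (form_cross a c d) (crossC d c).
  by rewrite (form_cross b d c) (form_cross b c d) (crossC d c); ring.
- by move=> x; rewrite !linE !(hc_sharp_sharp HC) !linE; field.
Qed.

Lemma cross_sq x y z :
  (x ** x) ** (y ** z) + 2%:R *: ((x ** y) ** (x ** z))
  = form (x ** x) y *: z + form (x ** x) z *: y
    + (2%:R * form (x ** y) z) *: x.
Proof.
have := cross4 x x y z => h.
have -> : form (x ** x) y *: z + form (x ** x) z *: y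
    + (2%:R * form (x ** y) z) *: x = form (x ** x) y *: z + form (x ** x) z *: y
    + form (x ** y) z *: x + form (x ** y) z *: x by vec.
by rewrite -h; vec.
Qed.

Lemma form_cross_swap a b y w : form (a ** (b ** y)) w = form y (b ** (a ** w)).
Proof. by rewrite crossC form_cross crossC form_cross. Qed.

(** The transpose of [cross_sq], as a map in its last argument, with respect to the form;
    multiplication by a fixed element is self-adjoint. *)
Lemma cross_adj x y z :
  z ** ((x ** x) ** y) + 2%:R *: (x ** ((x ** z) ** y))
  = form (x ** x) z *: y + form z y *: (x ** x) + (2%:R * form x y) *: (x ** z).
Proof.
apply: form_inj => w; have /(congr1 (form y)) := cross_sq x z w.
rewrite !linE !form_cross_swap => ->.
rewrite (formC y x) (formC y z) (formC y w) (form_cross x x w).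
by rewrite (formC x (x ** w)) (formC (x ** w)); ring.
Qed.


Lemma cross_sq0 x y z : x ** x = 0 ->
  (x ** y) ** (x ** z) = form (x ** y) z *: x.
Proof.
move=> x0; have := cross_sq x y z; rewrite x0 !linE !scale0r !add0r -scalerA.
by apply: scalerI; rewrite pnatr_eq0.
Qed.

Lemma cross_adj0 x y z : x ** x = 0 ->
  x ** ((x ** z) ** y) = form x y *: (x ** z).
Proof.
move=> x0; have := cross_adj x y z.
rewrite x0 !linE !scale0r scaler0 !add0r -scalerA.
by apply: scalerI; rewrite pnatr_eq0.
Qed.

(** * Orthogonality and rank-one tripotents *)

Lemma herm_inj x y : (forall w, '[x, w] = '[y, w]) -> x = y.
Proof. by move=> h; apply: form_inj => w; rewrite -(barK w). Qed.

Lemma hermC x y : '[x, y]^* = '[y, x].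
Proof. by rewrite -form_bar barK formC. Qed.

Lemma D_adj x y z w : '[D x y z, w] = '[z, D y x w].
Proof.
rewrite !DE !linE !bar_cross !barK !hermC (crossC x z) !form_cross.
rewrite (crossC (bar y)) (crossC x); ring.
Qed.

Lemma DC x y z : D x y z = D z y x.
Proof. by rewrite !DE (crossC x); vec. Qed.

Lemma orthogonal_sym x y : orthogonal D x y -> orthogonal D y x.
Proof.
move=> Dxy; apply/lfunP => z; apply: herm_inj => w.
by rewrite D_adj Dxy !lfunE /= !linE.
Qed.

(** By [cross_sq0] the cross term of the triple product cancels [(v : e ** z) e], and [(e : e ** z)]
    vanishes with [e ** e]. All orthogonal pairs constructed below come from here. *)
Lemma orthogonal_cross e z : e ** e = 0 -> orthogonal D e (bar (e ** z)).
Proof.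
move=> e0; apply/lfunP => v; rewrite DE lfunE /= barK cross_sq0 //.
by rewrite -(form_cross e e) e0 -(form_cross v) (crossC v e); vec.
Qed.

Definition rank1_unit e := e ** e = 0 /\ '[e, e] = 1.

Lemma rank1_unit_neq0 e : rank1_unit e -> e <> 0.
Proof. by case=> _ h e0; move: h; rewrite e0 form0l => /eqP; rewrite eq_sym oner_eq0. Qed.

Lemma rank1_tripotent e : rank1_unit e -> tripotent D e.
Proof. by case=> e0 e1; rewrite /tripotent DE e0 e1; vec. Qed.

(* The Peirce relation: on the eigenvalues 0, 1, 2 of [D e e] the polynomial
   t^2 - t vanishes except at 2, and the 2-eigenspace is the line through e. *)
Lemma D_rank1_sq e z : rank1_unit e ->
  D e e (D e e z) = D e e z + (2%:R * '[z, e]) *: e.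
Proof.
move=> [e0 e1].
have PT : '[(e ** z) ** bar e, e] = 0.
  by rewrite form_cross -bar_cross e0 !linE.
have TT : (e ** ((e ** z) ** bar e)) ** bar e = (e ** z) ** bar e.
  by rewrite cross_adj0 // e1 scale1r.
by rewrite !DE !linE e0 e1 TT PT; vec.
Qed.

Lemma D_orthogonal_tripotent e f g : tripotent D f -> orthogonal D f g ->
  e = f + g -> D e e f = 2%:R *: f.
Proof.
move=> tf /[dup] fg /orthogonal_sym gf ->.
have -> : D (f + g) (f + g) f = D f f f + D g f f + D f g f + D f g g.
  by rewrite [D f g g]DC !DE; vec.
by rewrite fg gf tf !lfunE /= !addr0.
Qed.

(** Orthogonality reduces [{ggg}] to [{eeg}], and [D e e] doubles both [e] and [f], hence
    [g = e - f]. *)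
Lemma tripotent_orthogonal_summand e f g : tripotent D e -> tripotent D f ->
  orthogonal D f g -> e = f + g -> tripotent D g.
Proof.
move=> te tf fg; have gf := orthogonal_sym fg; move=> efg.
have hf := D_orthogonal_tripotent tf fg efg.
have -> : tripotent D g <-> D e e g = 2%:R *: g.
  suff -> : D e e g = D g g g by [].
  rewrite efg; have -> : D (f + g) (f + g) g = D g f f + D g f g + D f g g + D g g g.
    by rewrite [D g f f]DC !DE; vec.
  by rewrite fg gf !lfunE /= !add0r.
have -> : g = e - f by rewrite efg addrC addKr.
by rewrite linearB /= te hf scalerBr.
Qed.

(** In a splitting [e = f + g] both summands lie in the 2-eigenspace of [D e e], the line through
    [e]; two nonzero multiples of [e] are not orthogonal. *)
Lemma rank1_minimal e : rank1_unit e -> minimal_tripotent D e.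
Proof.
move=> e1; split; [exact: rank1_tripotent | exact: rank1_unit_neq0|].
move=> [f [g [tf tg f0 g0 [fg efg]]]].
have fE : f = '[f, e] *: e.
  have := D_rank1_sq f e1; rewrite (D_orthogonal_tripotent tf fg efg).
  rewrite linearZ /= (D_orthogonal_tripotent tf fg efg) => h.
  have : 2%:R *: f = 2%:R *: ('[f, e] *: e).
    by apply: (@addrI _ (2%:R *: f)); rewrite scalerA -h; vec.
  by apply: scalerI; rewrite pnatr_eq0.
have gE : g = (1 - '[f, e]) *: e.
  by rewrite scalerBl scale1r -fE efg addrC addKr.
have : D f g f = 0 by rewrite fg lfunE.
case: (e1) => e0 e11.
rewrite DE {1 2 4}fE gE fE !linE e0 e11; move: ('[f, e]) fE gE => k fE gE h.
have /eqP : (k * (1 - k)^* * k * 2%:R) *: e = 0 by rewrite -[RHS]h; vec.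
rewrite scaler_eq0 !mulf_eq0 conjC_eq0 pnatr_eq0 orbF.
case/orP=> [/orP[/orP[]|]|] /eqP h0.
- by apply: f0; rewrite fE h0 scale0r.
- by apply: g0; rewrite gE h0 scale0r.
- by apply: f0; rewrite fE h0 scale0r.
- exact: (rank1_unit_neq0 e1).
Qed.

(** The factor is a square root of a positive number, hence real, so that scaling also respects
    antilinear fixed-point equations. *)
Lemma normalize x r : x <> 0 -> 0 < r ->
  exists k : C, [/\ k != 0, k^* = k & '[k *: x, k *: x] = r].
Proof.
move=> /(hc_pos HC) x0 r0; exists (sqrtC (r / '[x, x])).
have rx : 0 < r / '[x, x] by rewrite divr_gt0.
have kk : (sqrtC (r / '[x, x]))^* = sqrtC (r / '[x, x]).
  by apply/geC0_conj; rewrite sqrtC_ge0 ltW.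
split; rewrite ?kk //; first by rewrite sqrtC_eq0 gt_eqF.
by rewrite !linE kk mulrA -expr2 sqrtCK divfK ?gt_eqF.
Qed.

(** * The adjoint and the cubic norm *)

Definition sharp x := locked (2%:R^-1 *: (x ** x)).
Definition norm x := 3%:R^-1 * form x (sharp x).

Lemma sharpE x : sharp x = 2%:R^-1 *: (x ** x).
Proof. by rewrite /sharp -lock. Qed.

Lemma sharpD x y : sharp (x + y) = sharp x + x ** y + sharp y.
Proof. by rewrite !sharpE !linE (crossC y x); vec. Qed.

Lemma sharpZ k x : sharp (k *: x) = k ^+ 2 *: sharp x.
Proof. by rewrite !sharpE !linE; vec. Qed.

Lemma sharp_bar x : sharp (bar x) = bar (sharp x).
Proof. by rewrite !sharpE barZ bar_cross fmorphV rmorph_nat. Qed.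

Lemma sharp_eq0 x : sharp x = 0 <-> x ** x = 0.
Proof.
rewrite !sharpE; split=> [/eqP|->]; last by rewrite scaler0.
by rewrite scaler_eq0 invr_eq0 pnatr_eq0 => /eqP.
Qed.

(** This is [cross_adj] at [z = x], where both terms on the left are multiples of the same
    vector. *)
Lemma cross_sharp x y :
  x ** (sharp x ** y) = norm x *: y + form x y *: sharp x.
Proof.
have /(congr1 (fun v => 6%:R^-1 *: v)) := cross_adj x y x.
rewrite /norm !sharpE !linE formC => h.
have -> : 2%:R^-1 *: (x ** (x ** x ** y)) = 6%:R^-1 *:
   (x ** (x ** x ** y) + 2%:R *: (x ** (x ** x ** y))) by vec.
by rewrite h; vec.
Qed.

Lemma sharp_sharp x : sharp (sharp x) = norm x *: x.
Proof.
have /(congr1 (fun v => 24%:R^-1 *: v)) := cross_sq x x x.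
rewrite /norm !sharpE !linE formC => h.
have -> : 2%:R^-1 *: (2%:R^-1 *: (2%:R^-1 *: ((x ** x) ** (x ** x)))) = 24%:R^-1 *:
   ((x ** x) ** (x ** x) + 2%:R *: ((x ** x) ** (x ** x))) by vec.
by rewrite h; vec.
Qed.

Lemma sharp_cross x y : sharp (x ** y) =
  form x (sharp y) *: x + form (sharp x) y *: y - sharp x ** sharp y.
Proof.
have /(congr1 (fun v => 4%:R^-1 *: v)) := cross_sq x y y.
rewrite !sharpE !linE (form_cross x y y) => h.
have -> : 2%:R^-1 *: ((x ** y) ** (x ** y)) = 4%:R^-1 *:
   ((x ** x) ** (y ** y) + 2%:R *: ((x ** y) ** (x ** y)))
   - 4%:R^-1 *: ((x ** x) ** (y ** y)) by vec.
by rewrite h; vec.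
Qed.

(** * Splitting the tripotents that are not of rank one *)

Lemma tripotent_sharp e : tripotent D e ->
  sharp e ** bar e = ('[e, e] - 1) *: e.
Proof.
rewrite /tripotent DE => h.
have -> : sharp e ** bar e = '[e, e] *: e
      - 2%:R^-1 *: ('[e, e] *: e + '[e, e] *: e - e ** e ** bar e).
  by rewrite !sharpE; vec.
by rewrite h; vec.
Qed.

(* Here [s = e^#] has rank one and [y |-> - s x bar y] is an antilinear involution
   of the range of [s x _]; [u] is a fixed point of it orthogonal to [e]. *)
Lemma split_rank2 e : tripotent D e -> norm e = 0 -> sharp e <> 0 ->
  exists c d, [/\ rank1_unit c, rank1_unit d, orthogonal D c d & e = c + d].
Proof.
move=> te N0 s0.
have se := tripotent_sharp te.
have seb : e ** bar (sharp e) = ('[e, e] - 1) *: bar e.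
  have := congr1 bar se; rewrite bar_cross barK (barZ (_ - 1)) rmorphB rmorph1 /=.
  by rewrite hermC crossC => ->.
have eq_e y : e ** (sharp e ** y) = form e y *: sharp e.
  by rewrite cross_sharp N0 scale0r add0r.
have ss : sharp e ** sharp e = 0.
  by apply/sharp_eq0; rewrite sharp_sharp N0 scale0r.
(* With [t = (e | e)], the number [(e^# | e^#)] equals both [t (t - 1) / 2] and [(t - 1) ^+ 2]; as
   it is nonzero, [t = 2]. *)
have sse : '[sharp e, sharp e] = 2%:R^-1 * (('[e, e] - 1) * '[e, e]).
  by rewrite {1}sharpE formZl form_cross seb formZr.
have sst : '[sharp e, sharp e] = ('[e, e] - 1) ^+ 2.
  have := congr1 sharp se.
  rewrite sharpZ sharp_cross sharp_bar (proj2 (sharp_eq0 _) ss) !linE scale0r oppr0 !addr0.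
  move/eqP; rewrite -subr_eq0 -scalerBl scaler_eq0 subr_eq0.
  by case/orP => /eqP.
have tE : '[e, e] = 2%:R.
  have t1 : '[e, e] - 1 != 0.
    by apply/eqP => t1; have := hc_pos HC s0; rewrite sst t1 expr0n ltxx.
  have : '[e, e] - 1 = 2%:R^-1 * '[e, e].
    by apply: (mulfI t1); rewrite -expr2 -sst sse; ring.
  move: ('[e, e]) => t h.
  have -> : t = 2%:R * (t - 2%:R^-1 * t) by field.
  by rewrite -h; ring.
have {}sst : '[sharp e, sharp e] = 1 by rewrite sst tE; ring.
have t1 : '[e, e] - 1 = 1 by rewrite tE; ring.
rewrite t1 !scale1r in se seb.
move: s0 se seb eq_e ss sst {sse}.
move sE: (sharp e) => s s0 se seb eq_e ss sst.
have [z z0 sz0] := hc_cross_rank1 HC s0.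
pose y := s ** (z - (2%:R^-1 * '[s ** z, e]) *: bar e).
have yE : y = s ** z - (2%:R^-1 * '[s ** z, e]) *: e by rewrite /y !linE se.
(* If [y = 0] then [s ** z = k e] for some [k]. The cross square of [s ** z] is
   [(s : z ** z) s = 0], so [k = 0] or [e ** e = 0], and both are excluded. *)
have y0 : y <> 0.
  rewrite yE => /eqP; rewrite subr_eq0 => /eqP h.
  have := cross_sq0 z z ss; rewrite form_cross z0 form0r scale0r h !linE.
  move/eqP; rewrite !scaler_eq0 => /or3P[/eqP k0|/eqP k0|/eqP /sharp_eq0 k0].
  - by apply: sz0; rewrite h k0 scale0r.
  - by apply: sz0; rewrite h k0 scale0r.
  - by apply: s0; rewrite -sE k0.
have ye : '[y, e] = 0 by rewrite yE !linE tE; field.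
have se_conj v : '[s ** v, e] = form v e.
  by rewrite (crossC s) form_cross se.
have [y' [y'0 y's y'e]] : exists y', [/\ y' <> 0, s ** bar y' = - y' & '[y', e] = 0].
  have yss : s ** (bar s ** y) = y.
    by rewrite (crossC (bar s)) cross_adj0 // sst scale1r.
  have yse : '[s ** bar y, e] = 0 by rewrite se_conj -(barK e) form_bar ye conjC0.
  (* Adding to [y] its image under the involution gives a fixed point; if the sum is 0, the image is
     [- y] and antilinearity makes ['i *: y] fixed. *)
  case: (eqVneq (y - s ** bar y) 0) => [/eqP|/eqP yy]; last first.
    exists (y - s ** bar y); split=> //; last by rewrite !linE ye yse subrr.
    by rewrite barD barN crossDr crossNr bar_cross barK yss opprB.
  rewrite subr_eq0 => /eqP ysy; exists ('i *: y); split.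
  - by move/eqP; rewrite scaler_eq0 (negbTE (neq0Ci _)) /= => /eqP.
  - by rewrite barZ crossZr -ysy conjCi scaleNr.
  - by rewrite !linE ye mulr0.
have [u [us ue uu]] : exists u, [/\ s ** bar u = - u, '[u, e] = 0 & '[u, u] = 2%:R].
  have [k [k0 kk ku]] := normalize y'0 (ltr0n C 2).
  exists (k *: y'); split=> //; first by rewrite !linE kk y's scalerN.
  by rewrite !linE y'e mulr0.
have eu : '[e, u] = 0 by rewrite -hermC ue conjC0.
have exu : e ** u = 0 by rewrite -[u]opprK -us crossNr eq_e eu scale0r oppr0.
(* As [s^# = 0], the adjoint of [s ** bar u] is [(s : sharp (bar u)) s], that is [- (u | u) / 2]
   times [s]; this is why [u] was scaled to [(u | u) = 2]. *)
have su : sharp u = - s.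
  rewrite -[u]opprK -us !sharpE crossNl crossNr opprK -sharpE sharp_cross.
  rewrite (proj2 (sharp_eq0 _) ss) !linE scale0r oppr0 !addr0.
  rewrite sharpE formZr -form_cross us formNl uu -scaleN1r; congr (_ *: _).
  by field.
(* Since [e ** u = 0], the adjoint of [e + k u] is [s - k ^+ 2 s], which vanishes for [k = 1] and
   [k = -1]. *)
have half k : k ^+ 2 = 1 -> k^* = k -> rank1_unit (2%:R^-1 *: (e + k *: u)).
  move=> k2 kk; split.
    apply/sharp_eq0; rewrite sharpZ sharpD sharpZ k2 su sE !linE exu.
    by rewrite scaler0 addr0 scale1r subrr scaler0.
  rewrite !linE kk fmorphV rmorph_nat tE ue eu uu.
  by transitivity ((1 + k ^+ 2) / 2%:R : C); [field | rewrite k2; field].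
exists (2%:R^-1 *: (e + 1 *: u)), (2%:R^-1 *: (e + (- 1) *: u)); split.
- by apply: half; rewrite ?expr1n ?conjC1.
- by apply: half; rewrite ?sqrrN ?expr1n ?rmorphN1.
- have usb : u ** bar s = - bar u.
    by have := congr1 bar us; rewrite bar_cross barK barN crossC.
  (* Crossing with [bar s] sends [e] to [bar e] and [u] to [- bar u], so it exchanges the two halves
     up to [bar], as [orthogonal_cross] requires. *)
  have -> : 2%:R^-1 *: (e + -1 *: u) = bar (2%:R^-1 *: (e + 1 *: u) ** bar s).
    by rewrite !linE seb usb !linE !barK fmorphV rmorph_nat rmorph1; vec.
  by apply: orthogonal_cross; have [] := half 1 (expr1n _ _) (conjC1 _).
- by vec.
Qed.

Lemma split_rank3 e : tripotent D e -> norm e <> 0 ->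
  exists c d, [/\ rank1_unit c, tripotent D d, d <> 0, orthogonal D c d & e = c + d].
Proof.
move=> te n0.
have e0 : e <> 0 by move=> e0; apply: n0; rewrite /norm e0 form0l mulr0.
have n0' : norm e != 0 by apply/eqP.
have e0' : (e == 0) = false by apply/eqP.
have fes : form e (sharp e) = 3%:R * norm e by rewrite /norm; field.
have se := tripotent_sharp te.
(* Two evaluations of [e ** (e^# ** bar e)], by [cross_sharp] and by [tripotent_sharp]. Pairing the
   result with [e] gives [t = 3 (t - 2)] for [t = (e | e)]. *)
have nb : norm e *: bar e = ('[e, e] - 2%:R) *: sharp e.
  have := cross_sharp e (bar e); rewrite se crossZr => h.
  have -> : norm e *: bar e = ('[e, e] - 1) *: (e ** e) - '[e, e] *: sharp e by rewrite h; vec.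
  by rewrite !sharpE; vec.
have t3 : '[e, e] = 3%:R.
  have := congr1 (form e) nb; rewrite !formZr fes => h.
  have {h} h : norm e * '[e, e] = norm e * (('[e, e] - 2%:R) * 3%:R) by rewrite h; ring.
  move/(mulfI n0'): h; move: ('[e, e]) => t h.
  have -> : t = (3%:R * t - t) / 2%:R by field.
  by rewrite {2}h; field.
have sE : sharp e = norm e *: bar e.
  by rewrite nb t3 -[LHS]scale1r; congr (_ *: _); ring.
move: n0 n0' fes se sE {nb}; move: (norm e) (cross_sharp e) => n eq_e n0 n0' fes se sE.
have nn : n * n^* = 1.
  have := congr1 bar sE; rewrite -sharp_bar (barZ n) barK => h.
  have : (n * n^*) *: e = 1 *: e.
    rewrite -scalerA -h.
    have -> : n *: sharp (bar e) = 2%:R^-1 *: (sharp e ** bar e).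
      by rewrite sE crossZl !sharpE; vec.
    by rewrite se t3; vec.
  by move/eqP; rewrite -subr_eq0 -scalerBl scaler_eq0 e0' orbF subr_eq0 => /eqP.
have nV : n^* = n^-1 by rewrite -[RHS]mulr1 -nn mulKf.
have ebE : bar e = n^* *: sharp e by rewrite sE scalerA mulrC nn scale1r.
have ees : e ** e = 2%:R *: sharp e by rewrite !sharpE; vec.
(* This is [{e y e} / 2 = (e | y) e - e^# ** bar y], rewritten with [e^# = n bar e]. *)
pose sg y := '[e, y] *: e - n *: bar (e ** y).
have sgD x y : sg (x + y) = sg x + sg y by rewrite /sg !linE; vec.
have sgZ k x : sg (k *: x) = k^* *: sg x by rewrite /sg !linE; vec.
have eey y : e ** bar (e ** y) = bar y + (n^* * '[e, y]) *: sharp e.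
  by rewrite bar_cross ebE crossZl crossZr eq_e scalerDr !scalerA mulrC nn scale1r mulrC.
have esg y : e ** sg y = '[e, y] *: sharp e - n *: bar y.
  rewrite /sg crossDr crossNr !crossZr eey ees scalerDr !scalerA mulrA nn mul1r.
  by vec.
have bs : bar (sharp e) = n^* *: e by rewrite sE barZ barK.
have sge y : '[sg y, e] = '[e, y].
  rewrite /sg formDl formNl !formZl t3 form_bar crossC form_cross ees sE scalerA.
  rewrite formZr !rmorphM rmorph_nat /= hermC.
  have -> : '[e, y] * 3%:R - n * (2%:R * n^* * '[e, y])
      = '[e, y] * 3%:R - (n * n^*) * 2%:R * '[e, y] by ring.
  by rewrite nn; ring.
have sgK y : sg (sg y) = y.
  rewrite {1}/sg -hermC sge hermC esg barD barN !barZ bs barK.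
  rewrite hermC; transitivity (('[y, e] - n * n^* * '[y, e]) *: e + (n * n^*) *: y).
    by vec.
  by rewrite nn; vec.
(* [Q(e)] commutes with [y |-> bar (y^#)] up to the scalar [n^2]. *)
have sharp_sg y : sharp (sg y) = n ^+ 2 *: bar (sg (bar (sharp y))).
  have sey : form (sharp e) y = n * '[y, e] by rewrite sE formZl formC.
  rewrite /sg sharpD -scaleNr !sharpZ sharp_bar sharp_cross sey crossZl crossZr eey.
  rewrite !(barD, barN, barZ) (bar_cross (sharp e)) bs !barK rmorphM /= hermC nV.
  by rewrite crossZl; vec.
have sg0 : sg 0 = 0 by have := sgZ 0 0; rewrite conjC0 !scale0r.
have [c0 [c00 c0s sc0]] : exists c0, [/\ c0 <> 0, sharp c0 = 0 & sg c0 = c0].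
  have [v /sharp_eq0 sv ev] := hc_cross_rank1 HC e0.
  have v0 : v <> 0 by move=> v0; apply: ev; rewrite v0 cross0r.
  have ssv : sharp (sg v) = 0 by rewrite sharp_sg sv bar0 sg0 bar0 scaler0.
  have sgx : sg (v + sg v) = v + sg v by rewrite sgD sgK addrC.
  (* If [v + sg v = 0], then [sg v = - v] and ['i *: v] is fixed instead. *)
  case: (eqVneq (v + sg v) 0) => [/eqP|/eqP x0].
    rewrite addrC addr_eq0 => /eqP svv; exists ('i *: v); split.
    - by move/eqP; rewrite scaler_eq0 (negbTE (neq0Ci _)) /= => /eqP.
    - by rewrite sharpZ sv scaler0.
    - by rewrite sgZ conjCi svv scalerN scaleNr opprK.
  case: (eqVneq (sharp (v + sg v)) 0) => [sx|/eqP sx]; first by exists (v + sg v).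
  have sxE : sharp (v + sg v) = v ** sg v by rewrite sharpD sv ssv add0r addr0.
  (* A sum of two rank-one elements has norm 0: pairing it with [v ** sg v] only involves [v ** v]
     and [sg v ** sg v]. *)
  have nx : norm (v + sg v) = 0.
    rewrite /norm sxE formDl -form_cross (proj1 (sharp_eq0 _) sv) form0l add0r.
    by rewrite crossC -form_cross (proj1 (sharp_eq0 _) ssv) form0l mulr0.
  move: (v + sg v) sgx nx sx {sxE x0} => x sgx nx sx.
  have sgb : sg (bar (sharp x)) = n ^+ 2 *: bar (sharp x).
    have := congr1 (fun u => n ^+ 2 *: bar u) (sharp_sg x).
    rewrite sgx => ->; rewrite barZ barK scalerA rmorphXn /= -exprMn nn.
    by rewrite expr1n scale1r.
  (* The factor [n] absorbs the [n ^+ 2] of [sgb], because [n^* n ^+ 2 = n]. *)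
  exists (n *: bar (sharp x)); split.
  - move/eqP; rewrite scaler_eq0 (negbTE n0') /= => /eqP h.
    by apply: sx; rewrite -(barK (sharp x)) h bar0.
  - by rewrite sharpZ sharp_bar sharp_sharp nx scale0r bar0 scaler0.
  - by rewrite sgZ sgb scalerA expr2 mulrA (mulrC n^* n) nn mul1r.
have c0c0 : c0 ** c0 = 0 by apply/sharp_eq0.
(* That [c0] is fixed by [sg] makes [r] real and [(c0 | c0) = r ^+ 2], so [r^-1 *: c0] has norm
   1. *)
pose r := '[e, c0].
have rr : r^* = r by rewrite /r hermC -{1}sc0 sge.
have c0r : '[c0, c0] = r ^+ 2.
  rewrite -{1}sc0 /sg formDl formNl !formZl form_bar form_cross c0c0 form0r.
  by rewrite conjC0 mulr0 subr0 -/r expr2.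
have r0 : r != 0.
  by apply/eqP => r0; have := hc_pos HC c00; rewrite c0r r0 expr0n ltxx.
have rV : (r^-1)^* = r^-1 by rewrite fmorphV /= rr.
have c1 : rank1_unit (r^-1 *: c0).
  by split; rewrite !linE ?c0c0 ?scaler0 // c0r rV; field.
have cd : orthogonal D (r^-1 *: c0) (e - r^-1 *: c0).
  (* Solving [sg c0 = c0] for [e] exhibits the remainder in the form needed by
     [orthogonal_cross]. *)
  have -> : e - r^-1 *: c0 = bar (r^-1 *: c0 ** (n^* *: e)).
    have := sc0; rewrite /sg -/r => h; rewrite -{1}h crossZl crossZr !barZ conjCK rV crossC.
    by vec.
  by apply: orthogonal_cross; case: c1.
exists (r^-1 *: c0), (e - r^-1 *: c0); split=> //; last by rewrite addrC subrK.
- apply: (tripotent_orthogonal_summand te (rank1_tripotent c1) cd).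
  by rewrite addrC subrK.
- move/eqP; rewrite subr_eq0 => /eqP ec.
  have : 3%:R * n = 0 by rewrite -fes {2}ec sharpZ c0s scaler0 form0r.
  by move/eqP; rewrite mulf_eq0 pnatr_eq0 (negbTE n0').
Qed.

Lemma minimal_rank1 e : minimal_tripotent D e -> rank1_unit e.
Proof.
move=> [te e0 dec].
have [se|/eqP se] := eqVneq (sharp e) 0.
  have e2 : e ** e = 0 by apply/sharp_eq0.
  split=> //; move: te; rewrite /tripotent DE e2 cross0l subr0 -scalerDl.
  move/eqP; rewrite -subr_eq0 -scalerBl scaler_eq0 => /orP[|/eqP //].
  rewrite subr_eq0 => /eqP h; move: ('[e, e]) h => t h.
  by transitivity ((t + t) / 2%:R : C); [field | rewrite h; field].
case: dec; have [ne|/eqP ne] := eqVneq (norm e) 0.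
  have [c [d [c1 d1 cd ecd]]] := split_rank2 te ne se.
  exists c, d; split=> //; do ?[exact: rank1_tripotent | exact: rank1_unit_neq0].
have [c [d [c1 td d0 cd ecd]]] := split_rank3 te ne.
by exists c, d; split=> //; [exact: rank1_tripotent | exact: rank1_unit_neq0].
Qed.

(** * Frames *)

Lemma orthogonal_herm x y : rank1_unit x -> orthogonal D x y -> '[x, y] = 0.
Proof.
move=> [x0 _] xy; have : D x y x = 0 by rewrite xy lfunE.
rewrite DE x0 cross0l subr0 -scalerDl -mulr2n => /eqP; rewrite scaler_eq0.
case/orP=> /eqP; first by move/eqP; rewrite mulrn_eq0 => /eqP.
by move=> ->; rewrite form0l.
Qed.

Lemma orthogonal_cross_bar x y : rank1_unit x -> rank1_unit y ->
  orthogonal D x y -> (x ** y) ** bar y = x.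
Proof.
move=> x1 [y0 y1] xy; have : D x y y = 0 by rewrite xy lfunE.
rewrite DE (orthogonal_herm x1 xy) y1 scale0r add0r scale1r.
by move/eqP; rewrite subr_eq0 => /eqP.
Qed.

Lemma orthogonal_third x y : rank1_unit x -> rank1_unit y -> orthogonal D x y ->
  [/\ rank1_unit (bar (x ** y)), orthogonal D x (bar (x ** y)),
      orthogonal D y (bar (x ** y)) &
      forall z, D x x z + D y y z + D (bar (x ** y)) (bar (x ** y)) z = 2%:R *: z].
Proof.
move=> x1 y1 xy; have yx := orthogonal_sym xy.
have w_y := congr1 bar (orthogonal_cross_bar x1 y1 xy).
have w_x := congr1 bar (orthogonal_cross_bar y1 x1 yx).
rewrite bar_cross barK in w_y; rewrite (crossC y x) bar_cross barK in w_x.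
have [x0 xx] := x1; have [y0 yy] := y1.
have w1 : rank1_unit (bar (x ** y)).
  split; last by rewrite barK formC form_cross crossC w_y xx.
  by rewrite -bar_cross cross_sq0 // form_cross y0 form0r scale0r bar0.
split=> //; first exact: orthogonal_cross.
  by rewrite crossC; exact: orthogonal_cross.
move=> z; move wE: (bar (x ** y)) w1 w_x w_y => w [_ ww] w_x w_y.
(* The cross product of any two of [x], [y], [w] is the conjugate of the third, so [cross4] becomes
   a sum over the three elements. *)
have := cross4 x y w z.
have -> : x ** y = bar w by rewrite -wE barK.
rewrite (crossC x w) w_x (crossC y w) w_y => h.
have {h} : bar w ** (w ** z) + bar y ** (y ** z) + bar x ** (x ** z)
    = z + '[z, w] *: w + '[z, y] *: y + '[z, x] *: x.
  by rewrite h !(formC (bar _)) ww scale1r.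
rewrite !DE xx yy ww !(crossC (_ ** z)) => h.
transitivity (3%:R *: z + ('[z, w] *: w + '[z, y] *: y + '[z, x] *: x)
    - (bar w ** (w ** z) + bar y ** (y ** z) + bar x ** (x ** z))); first by vec.
by rewrite h; vec.
Qed.

(** Otherwise [x] could be adjoined to the frame, so by maximality it would be a member and
    orthogonal to itself. *)
Lemma frame_meets c x : frame D c -> rank1_unit x ->
  ~ (forall y, y \in c -> orthogonal D x y).
Proof.
move=> [[minc ortc] maxc] x1 xc.
have : orthogonal_family D (x :: c).
  split=> [e|[|i] [|j] //= ic jc ij].
  - by rewrite inE => /predU1P[->|/minc //]; exact: rank1_minimal.
  - by apply: xc; rewrite mem_nth.
  - by apply: orthogonal_sym; apply: xc; rewrite mem_nth.
  - by apply: ortc => // eij; apply: ij; rewrite eij.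
move/maxc => /(_ _ x (mem_head _ _)) xin.
have /xc : x \in c by apply: xin => y yc; rewrite inE yc orbT.
move=> xx; have := rank1_tripotent x1; rewrite /tripotent xx lfunE /= => /esym/eqP.
by rewrite scaler_eq0 pnatr_eq0 => /eqP; exact: rank1_unit_neq0.
Qed.

Lemma exists_rank1_unit : exists e, rank1_unit e.
Proof.
have [x x0] := hc_nonzero HC; have [z zz xz] := hc_cross_rank1 HC x0.
have z0 : z <> 0 by move=> z0; apply: xz; rewrite z0 cross0r.
have [k [_ _ k1]] := normalize z0 ltr01.
by exists (k *: z); split; rewrite // !linE zz !scaler0.
Qed.

Lemma exists_orthogonal e : rank1_unit e ->
  exists2 f, rank1_unit f & orthogonal D e f.
Proof.
move=> e1; have [z zz ez] := hc_cross_rank1 HC (rank1_unit_neq0 e1).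
have [e0 _] := e1.
have y0 : bar (e ** z) <> 0 by move=> h; apply: ez; rewrite -(barK (e ** z)) h bar0.
have [k [_ _ k1]] := normalize y0 ltr01.
exists (k *: bar (e ** z)).
  split=> //; rewrite !linE -bar_cross cross_sq0 // form_cross zz form0r.
  by rewrite scale0r bar0 !scaler0.
have -> : k *: bar (e ** z) = bar (e ** (k^* *: z)) by rewrite crossZr barZ conjCK.
exact: orthogonal_cross.
Qed.

(** Maximality is kept in the computable form [D1 + D2 + D3 = 2]. *)
Definition rank1_frame c1 c2 c3 :=
  [/\ rank1_unit c1, rank1_unit c2 & rank1_unit c3] /\
  [/\ orthogonal D c1 c2, orthogonal D c1 c3, orthogonal D c2 c3 &
      forall z, D c1 c1 z + D c2 c2 z + D c3 c3 z = 2%:R *: z].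

Lemma D_orthogonal x y : orthogonal D x y -> D x x y = 0.
Proof. by move/orthogonal_sym => yx; rewrite DC yx lfunE. Qed.

Lemma D_rank1_eigen2 e z : rank1_unit e -> D e e z = 2%:R *: z -> z = '[z, e] *: e.
Proof.
move=> e1 h; have := D_rank1_sq z e1; rewrite h linearZ /= h => {}h.
have : 2%:R *: z = 2%:R *: ('[z, e] *: e).
  by apply: (@addrI _ (2%:R *: z)); rewrite scalerA -h; vec.
by apply: scalerI; rewrite pnatr_eq0.
Qed.

(** A frame with fewer than three members could be enlarged. All members after the first two are
    multiples of [w = bar (c1 ** c2)], so orthogonality allows only one of them. *)
Lemma frame_rank1 c : frame D c ->
  exists c1 c2 c3, c = [:: c1; c2; c3] /\ rank1_frame c1 c2 c3.
Proof.
move=> fc; have [[minc ortc] _] := fc.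
have unit i : (i < size c)%N -> rank1_unit c`_i.
  by move=> ic; apply: minimal_rank1; apply: minc; rewrite mem_nth.
have ort i j : [&& i < size c, j < size c & i != j]%N -> orthogonal D c`_i c`_j.
  by case/and3P=> ic jc /eqP; exact: ortc.
case: c fc {minc ortc} ort unit => [|c1 [|c2 [|c3 c]]] fc ort unit.
- have [e e1] := exists_rank1_unit.
  by case: (frame_meets fc e1).
- have c11 := unit 0%N isT; have [f f1 cf] := exists_orthogonal c11.
  case: (frame_meets fc f1) => y; rewrite inE => /eqP ->.
  exact: orthogonal_sym.
- have [w1 w_c1 w_c2 _] := orthogonal_third (unit 0%N isT) (unit 1%N isT) (ort 0%N 1%N isT).
  case: (frame_meets fc w1) => y; rewrite !inE => /orP[]/eqP ->; exact: orthogonal_sym.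
have c12 : orthogonal D c1 c2 by apply: (ort 0%N 1%N).
have c13 : orthogonal D c1 c3 by apply: (ort 0%N 2%N).
have c23 : orthogonal D c2 c3 by apply: (ort 1%N 2%N).
have c11 : rank1_unit c1 by apply: (unit 0%N).
have c21 : rank1_unit c2 by apply: (unit 1%N).
have c31 : rank1_unit c3 by apply: (unit 2%N).
have [w1 _ _ sum] := orthogonal_third c11 c21 c12.
move: (bar _) w1 sum => w w1 sum.
have multw x : orthogonal D c1 x -> orthogonal D c2 x -> x = '[x, w] *: w.
  move=> /D_orthogonal c1x /D_orthogonal c2x; apply: D_rank1_eigen2 => //.
  by rewrite -sum c1x c2x !add0r.
have c3w := multw c3 c13 c23.
case: c fc ort unit => [|c4 c] fc ort unit.
  exists c1, c2, c3; split=> //; split=> //; split=> // z.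
  (* Here [c3 = k w] with [k k^* = 1], so the sum relation passes from [w] to [c3]. *)
  suff -> : D c3 c3 z = D w w z by [].
  have [_ c33] := c31; move: ('[c3, w]) c3w => k c3w.
  have kk : k * k^* = 1.
    by move: c33; rewrite c3w !linE (proj2 w1) mulrC -mulrA mul1r => <-; rewrite mulrC.
  rewrite !DE c3w.
  transitivity ((k * k^*) *: ('[w, w] *: z + '[z, w] *: w - (w ** z) ** bar w)); last first.
    by rewrite kk scale1r.
  by vec.
have c4w := multw c4 (ort 0%N 3%N isT) (ort 1%N 3%N isT).
have c34 : orthogonal D c3 c4 by apply: (ort 2%N 3%N).
have : '[c3, c4] = 0 by apply: orthogonal_herm.
have c41 : rank1_unit c4 by apply: (unit 3%N).
rewrite c3w c4w !linE (proj2 w1) mulr1 => /eqP; rewrite mulf_eq0 conjC_eq0.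
case/orP=> /eqP h.
  by case: (rank1_unit_neq0 c31); rewrite c3w h scale0r.
by case: (rank1_unit_neq0 c41); rewrite c4w h scale0r.
Qed.

Lemma exists_frame : exists c, frame D c.
Proof.
have [e e1] := exists_rank1_unit; have [f f1 ef] := exists_orthogonal e1.
have [w1 ew fw sum] := orthogonal_third e1 f1 ef.
move: (bar _) w1 ew fw sum => w w1 ew fw sum.
exists [:: e; f; w]; split.
  split=> [x|i j].
    by rewrite !inE => /or3P[]/eqP ->; exact: rank1_minimal.
  case: i => [|[|[|//]]]; case: j => [|[|[|//]]] //= _ _ _ //; exact: orthogonal_sym.
(* A further member [x] of [d] would be killed by all three operators, whose sum is multiplication
   by 2. *)
move=> d [mind ortd] sub x xd; apply/negPn/negP => xc.
have ort y : y \in [:: e; f; w] -> D y y x = 0.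
  move=> yc; apply: D_orthogonal.
  have yd := sub y yc.
  rewrite -(nth_index 0 xd) -(nth_index 0 yd); apply: ortd; rewrite ?index_mem //.
  by move=> h; move: xc; rewrite -(nth_index 0 xd) -h nth_index // yc.
have [_ x0 _] := mind x xd; apply: x0; apply/eqP.
have := sum x; rewrite !ort ?inE ?eqxx ?orbT // !addr0 => /esym/eqP.
by rewrite scaler_eq0 pnatr_eq0.
Qed.

Lemma rank1_frame_rot c1 c2 c3 : rank1_frame c1 c2 c3 -> rank1_frame c2 c3 c1.
Proof.
move=> [[c11 c21 c31] [c12 c13 c23 sum]]; split=> //.
split=> //; do ?exact: orthogonal_sym.
by move=> z; rewrite -sum addrC addrA.
Qed.

Lemma rank1_frame_swap c1 c2 c3 : rank1_frame c1 c2 c3 -> rank1_frame c2 c1 c3.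
Proof.
move=> [[c11 c21 c31] [c12 c13 c23 sum]]; split=> //.
split=> //; do ?exact: orthogonal_sym.
by move=> z; rewrite -sum (addrC (D c2 c2 z)).
Qed.

(* Eliminating the third operator, [D3 = 2 - D1 - D2], from [D3^2 = D3 + 2 P3]
   gives [D1 D2 + D2 D1]; multiplying that by [D1] on either side gives
   [D1 D2 D1 = D1 D2 = D2 D1]. *)
Lemma D_frame_comm c1 c2 c3 z : rank1_frame c1 c2 c3 ->
  D c1 c1 (D c2 c2 z) = D c2 c2 (D c1 c1 z) /\
  D c1 c1 (D c2 c2 (D c1 c1 z)) = D c1 c1 (D c2 c2 z).
Proof.
move=> [[c11 c21 c31] [c12 c13 c23 sum]].
have c21o := orthogonal_sym c12; have c31o := orthogonal_sym c13.
have c32o := orthogonal_sym c23.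
have anti u : D c1 c1 (D c2 c2 u) + D c2 c2 (D c1 c1 u) =
    2%:R *: (D c1 c1 u + D c2 c2 u - u)
    - (2%:R * '[u, c1]) *: c1 - (2%:R * '[u, c2]) *: c2 + (2%:R * '[u, c3]) *: c3.
  have E v : D c3 c3 v = 2%:R *: v - D c1 c1 v - D c2 c2 v by rewrite -sum; vec.
  have h := D_rank1_sq u c31.
  rewrite !E !linearB !linearZ /= (D_rank1_sq u c11) (D_rank1_sq u c21) in h.
  transitivity (2%:R *: (D c1 c1 u + D c2 c2 u - u)
    - (2%:R * '[u, c1]) *: c1 - (2%:R * '[u, c2]) *: c2
    - (2%:R *: u - D c1 c1 u - D c2 c2 u)
    + (2%:R *: u - D c1 c1 u - D c2 c2 u + (2%:R * '[u, c3]) *: c3)); last by vec.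
  by rewrite -h; vec.
have P2 v : '[D c2 c2 v, c1] = 0 by rewrite D_adj (D_orthogonal c21o) bar0 form0r.
have P12 : '[D c1 c1 z, c2] = 0 by rewrite D_adj (D_orthogonal c12) bar0 form0r.
have P13 : '[D c1 c1 z, c3] = 0 by rewrite D_adj (D_orthogonal c13) bar0 form0r.
have P11 : '[D c1 c1 z, c1] = 2%:R * '[z, c1].
  by rewrite D_adj (rank1_tripotent c11) barZ rmorph_nat formZr.
have h1 : D c1 c1 (D c2 c2 (D c1 c1 z)) = D c1 c1 (D c2 c2 z).
  have := congr1 (D c1 c1) (anti z).
  rewrite !(linearD, linearB, linearZ, linearN) /= !(D_rank1_sq _ c11) (rank1_tripotent c11).
  rewrite (D_orthogonal c12) (D_orthogonal c13) P2 => h.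
  transitivity (D c1 c1 (D c2 c2 z) + (2%:R * 0) *: c1 + D c1 c1 (D c2 c2 (D c1 c1 z))
     - D c1 c1 (D c2 c2 z)); first by vec.
  by rewrite h; vec.
have h2 : D c1 c1 (D c2 c2 (D c1 c1 z)) = D c2 c2 (D c1 c1 z).
  have := anti (D c1 c1 z).
  rewrite (D_rank1_sq _ c11) P11 P12 P13 linearD linearZ /= (D_orthogonal c21o) => h.
  transitivity (D c1 c1 (D c2 c2 (D c1 c1 z))
     + (D c2 c2 (D c1 c1 z) + (2%:R * '[z, c1]) *: 0) - D c2 c2 (D c1 c1 z)); first by vec.
  by rewrite h; vec.
by split; [rewrite -h1 h2 | exact: h1].
Qed.

(** * Dimensions of the off-diagonal Peirce spaces *)

Lemma lfun_trace_D e : rank1_unit e -> lfun_trace (D e e) = 18%:R.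
Proof. by case=> _ e1; rewrite (hc_trace HC) e1 mulr1. Qed.

(** By the Peirce relation, the square of [D e e] minus [D e e] is twice a rank-one projection, so
    its trace is 2. *)
Lemma lfun_trace_D_sq e : rank1_unit e -> lfun_trace (D e e \o D e e)%VF = 20%:R.
Proof.
move=> e1.
have : lfun_trace ((D e e \o D e e)%VF + (-1) *: D e e) = 2%:R.
  rewrite (@lfun_trace_line _ _ _ (fun z => '[z, e]) (2%:R *: e)).
  - by rewrite formZl (proj2 e1) mulr1.
  - by move=> k x y; rewrite formDl formZl.
  by move=> z; rewrite add_lfunE comp_lfunE scale_lfunE D_rank1_sq //; vec.
rewrite lfun_traceD lfun_traceZ lfun_trace_D // => /eqP.
rewrite mulN1r subr_eq => /eqP ->; ring.
Qed.

Lemma memv_limg_DD c1 c2 c3 z : rank1_frame c1 c2 c3 ->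
  z \in limg (D c1 c1 \o D c2 c2)%VF <->
  [/\ D c1 c1 z = z, D c2 c2 z = z & D c3 c3 z = 0].
Proof.
move=> fr; have fr' := rank1_frame_swap fr.
split=> [/memv_imgP[u _ ->]|[z1 z2 _]]; last first.
  by rewrite -z1 -{1}z2 -comp_lfunE memv_img ?memvf.
rewrite comp_lfunE; set v := D c1 c1 (D c2 c2 u).
have v1 : D c1 c1 v = v.
  case: fr => [[c11 _ _] [c12 _ _ _]].
  rewrite /v D_rank1_sq // D_adj (D_orthogonal (orthogonal_sym c12)) bar0 form0r.
  by rewrite mulr0 scale0r addr0.
have v2 : D c2 c2 v = v.
  by rewrite /v (D_frame_comm _ fr').2 -(D_frame_comm _ fr).1.
split=> //; have [_ [_ _ _ /(_ v)]] := fr; rewrite v1 v2 => h.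
by apply: (@addrI _ (v + v)); rewrite h addr0 -mulr2n scaler_nat.
Qed.

Lemma lfun_trace_DD c1 c2 c3 : rank1_frame c1 c2 c3 ->
  lfun_trace (D c1 c1 \o D c2 c2)%VF = (\dim (limg (D c1 c1 \o D c2 c2)%VF))%:R.
Proof.
move=> fr; apply: lfun_trace_idem; apply/lfunP => z; rewrite comp_lfunE.
have : (D c1 c1 \o D c2 c2)%VF z \in limg (D c1 c1 \o D c2 c2)%VF by rewrite memv_img ?memvf.
by case/(memv_limg_DD _ fr) => h1 h2 _; rewrite [LHS]comp_lfunE h2 h1.
Qed.

(** [D1 (D2 + D3) = D1 (2 - D1)] has trace [2 * 18 - 20]. *)
Lemma dim_limg_DD_sum c1 c2 c3 : rank1_frame c1 c2 c3 ->
  (\dim (limg (D c1 c1 \o D c2 c2)%VF) + \dim (limg (D c1 c1 \o D c3 c3)%VF) = 16)%N.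
Proof.
move=> fr; have [[c11 _ _] [_ _ _ sum]] := fr.
have fr' := rank1_frame_swap (rank1_frame_rot (rank1_frame_rot fr)).
apply/eqP; rewrite -(eqr_nat C) natrD -(lfun_trace_DD fr) -(lfun_trace_DD fr').
rewrite -lfun_traceD.
have -> : (D c1 c1 \o D c2 c2)%VF + (D c1 c1 \o D c3 c3)%VF
    = 2%:R *: D c1 c1 + (-1) *: (D c1 c1 \o D c1 c1)%VF.
  apply/lfunP => z; rewrite !(add_lfunE, comp_lfunE, scale_lfunE).
  have := congr1 (D c1 c1) (sum z); rewrite !linearD linearZ /= => <-.
  by vec.
rewrite lfun_traceD !lfun_traceZ lfun_trace_D // lfun_trace_D_sq //.
by apply/eqP; ring.
Qed.

Lemma limg_DDC c1 c2 c3 : rank1_frame c1 c2 c3 ->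
  limg (D c1 c1 \o D c2 c2)%VF = limg (D c2 c2 \o D c1 c1)%VF.
Proof.
move=> fr; congr lfun_img; apply/lfunP => z; rewrite !comp_lfunE.
exact: (D_frame_comm _ fr).1.
Qed.

(** Rotating the frame shows that three dimensions have all their pairwise sums equal to 16. *)
Lemma dim_limg_DD c1 c2 c3 (W : {vspace V}) : rank1_frame c1 c2 c3 ->
  (forall z, z \in W <-> [/\ D c1 c1 z = z, D c2 c2 z = z & D c3 c3 z = 0]) ->
  \dim W = 8%N.
Proof.
move=> fr memW; have fr2 := rank1_frame_rot fr; have fr3 := rank1_frame_rot fr2.
have -> : W = limg (D c1 c1 \o D c2 c2)%VF.
  by apply/vspaceP => z; apply/idP/idP; rewrite memW (memv_limg_DD _ fr).
have := dim_limg_DD_sum fr; have := dim_limg_DD_sum fr2; have := dim_limg_DD_sum fr3.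
rewrite (limg_DDC fr) (limg_DDC fr2) (limg_DDC fr3).
move: (\dim _) (\dim _) (\dim _) => a b c; lia.
Qed.

(** * Rank and the invariants [a] and [b] *)

Lemma memv_peirce c i j z : z \in peirce D c i j <->
  forall k, (k < size c)%N ->
    D c`_k c`_k z = ((i == k.+1) + (j == k.+1))%:R *: z.
Proof.
have eigen f a : (z \in passmx.leigenspace f a) = (f z == a *: z).
  by rewrite memv_ker add_lfunE opp_lfunE scale_lfunE id_lfunE subr_eq0.
rewrite memvE; split=> [/subv_bigcapP h k kc | h].
  by apply/eqP; have := h (Ordinal kc) isT; rewrite -memvE eigen.
by apply/subv_bigcapP => k _; rewrite -memvE eigen; apply/eqP/h.
Qed.

Lemma memv_peirce3 c1 c2 c3 i j z : z \in peirce D [:: c1; c2; c3] i j <->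
  [/\ D c1 c1 z = ((i == 1) + (j == 1))%:R *: z,
      D c2 c2 z = ((i == 2) + (j == 2))%:R *: z &
      D c3 c3 z = ((i == 3) + (j == 3))%:R *: z]%N.
Proof.
split=> [/memv_peirce h|[h1 h2 h3]].
  by split; [apply: (h 0%N) | apply: (h 1%N) | apply: (h 2%N)].
by apply/memv_peirce => -[|[|[|]]].
Qed.

Lemma hermitian_cubic_rank : is_rank D 3.
Proof.
split=> [|c fc]; first exact: exists_frame.
by have [c1 [c2 [c3 [-> _]]]] := frame_rank1 fc.
Qed.

Lemma hermitian_cubic_inv_a : is_inv_a D 8.
Proof.
split=> [|c fc i j i1 ij]; first exact: exists_frame.
have [c1 [c2 [c3 [-> fr]]]] := frame_rank1 fc => /= jc.
have fr12 := fr; have fr23 := rank1_frame_rot fr.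
have fr13 := rank1_frame_swap (rank1_frame_rot fr23).
have [[-> ->]|[[-> ->]|[-> ->]]] : (i = 1 /\ j = 2 \/ i = 1 /\ j = 3 \/ i = 2 /\ j = 3)%N by lia.
- apply: (dim_limg_DD fr12) => z; rewrite memv_peirce3 !scale1r scale0r.
  by split=> -[].
- apply: (dim_limg_DD fr13) => z; rewrite memv_peirce3 !scale1r scale0r.
  by split=> -[].
- apply: (dim_limg_DD fr23) => z; rewrite memv_peirce3 !scale1r scale0r.
  by split=> -[].
Qed.

(** On [V_0i] one of the three operators is 1 and the other two are 0, while their sum is 2. *)
Lemma hermitian_cubic_inv_b : is_inv_b D 0.
Proof.
split=> [|c fc i i1]; first exact: exists_frame.
have [c1 [c2 [c3 [-> [_ [_ _ _ sum]]]]]] := frame_rank1 fc => /= ic.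
apply/eqP; rewrite dimv_eq0 -subv0; apply/subvP => z /memv_peirce3[h1 h2 h3].
rewrite memv0; have := sum z; rewrite h1 h2 h3 -!scalerDl -!natrD => /eqP.
rewrite -subr_eq0 -scalerBl scaler_eq0 => /orP[|//].
have i3 : (i = 1 \/ i = 2 \/ i = 3)%N by lia.
by case: i3 => [->|[->|->]]; rewrite /= subr_eq0 eqr_nat.
Qed.

(* [D u x u = 2 (u | x) u]: an ideal contains every rank-one element that is
   not orthogonal to one of its members. *)
Lemma ideal_rank1 (I : {vspace V}) x u :
  (forall x y z, y \in I -> D x y z \in I) ->
  x \in I -> u ** u = 0 -> '[u, x] != 0 -> u \in I.
Proof.
move=> idI xI uu ux; have := idI u x u xI.
rewrite DE uu cross0l subr0 -mulr2n -scaler_nat scalerA rpredZeq.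
by rewrite mulf_eq0 pnatr_eq0 (negbTE ux).
Qed.

End HermitianCubic.

(** * Composition identities of the octonions *)

Section OctonionIdentities.
Variable K : fieldType.
Implicit Types x y z w : oct K.

Lemma oconj_mul x y : oconj (omul x y) = omul (oconj y) (oconj x).
Proof.
apply: oct_eq => [|m].
  rewrite ore_conj !ore_mul !ore_conj mulrC; congr (_ - _).
  by apply: eq_bigr => m _; rewrite !oim_conj mulrNN mulrC.
by rewrite oim_conj !oim_mul !oim_conj !ore_conj; ring.
Qed.

Lemma onorm_conj x : onorm (oconj x) = onorm x.
Proof.
by rewrite /onorm ore_conj; congr (_ + _); apply: eq_bigr => m _; rewrite oim_conj sqrrN.
Qed.

Lemma oconjZ k x : oconj (k *: x) = k *: oconj x.
Proof. by apply: oct_eq => [|m]; rewrite !(ore_conj, oim_conj, octE) ?mulrN. Qed.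

Lemma oconjN x : oconj (- x) = - oconj x.
Proof. by rewrite -scaleN1r oconjZ scaleN1r. Qed.

Lemma oconjD x y : oconj (x + y) = oconj x + oconj y.
Proof. by have := oconj_linear 1 x y; rewrite !scale1r. Qed.

Lemma omulDl x y z : omul (x + y) z = omul x z + omul y z.
Proof. by have := omul_linearl z 1 x y; rewrite !scale1r. Qed.

Lemma omulDr x y z : omul z (x + y) = omul z x + omul z y.
Proof. by have := omul_linearr z 1 x y; rewrite !scale1r. Qed.

Lemma omul0l z : omul 0 z = 0.
Proof. by apply: (@addrI _ (omul 0 z)); rewrite -omulDl !addr0. Qed.

Lemma omul0r z : omul z 0 = 0.
Proof. by apply: (@addrI _ (omul z 0)); rewrite -omulDr !addr0. Qed.

Lemma omulZl k x z : omul (k *: x) z = k *: omul x z.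
Proof. by have := omul_linearl z k x 0; rewrite omul0l !addr0. Qed.

Lemma omulNr x z : omul z (- x) = - omul z x.
Proof. by apply: (@addrI _ (omul z x)); rewrite -omulDr !subrr omul0r. Qed.

Lemma omulNl x z : omul (- x) z = - omul x z.
Proof. by apply: (@addrI _ (omul x z)); rewrite -omulDl !subrr omul0l. Qed.

Lemma omulZr k x z : omul z (k *: x) = k *: omul z x.
Proof. by have := omul_linearr z k x 0; rewrite omul0r !addr0. Qed.

Definition obase (k : unit + 'I_7) : oct K :=
  match k with inl _ => oscal 1 | inr m => (0 : K^o, delta_mx 0 m) end.

Definition ocoord x (k : unit + 'I_7) : K :=
  match k with inl _ => ore x | inr m => oim x m end.

Lemma oct_eq_coord x y : ocoord x =1 ocoord y -> x = y.
Proof.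
by move=> h; apply: oct_eq => [|m]; [apply: (h (inl tt)) | apply: (h (inr m))].
Qed.

Lemma ocoord_scalar k : scalar (ocoord^~ k).
Proof. by case: k => [?|m] c x y; rewrite /ocoord ?oimD ?oimZ. Qed.

Lemma ocoord_base k l : ocoord (obase l) k = (l == k)%:R.
Proof.
case: k l => [[]|m] [[]|m'] //=; rewrite /oim mxE ?eqxx ?[m == _]eq_sym //.
Qed.

Lemma oct_sum_base x : x = \sum_k ocoord x k *: obase k.
Proof.
apply: oct_eq_coord => l.
have coord0 k : ocoord 0 k = 0 by case: k => [?|m] //=; rewrite /oim mxE.
have coordD y z k : ocoord (y + z) k = ocoord y k + ocoord z k.
  by have := ocoord_scalar k 1 y z; rewrite scale1r mul1r.
have coordZ c y k : ocoord (c *: y) k = c * ocoord y k.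
  by have := ocoord_scalar k c y 0; rewrite addr0 coord0 addr0.
rewrite (big_morph (ocoord^~ l) (fun y z => coordD y z l) (coord0 l)).
rewrite (bigD1 l) //= coordZ ocoord_base eqxx mulr1 big1 ?addr0 // => k /negbTE kl.
by rewrite coordZ ocoord_base kl mulr0.
Qed.

Lemma oform_base x k : oform x (obase k) = 2%:R * ocoord x k.
Proof.
rewrite oformE; congr (_ * _); case: k => [[]|m] /=.
  by rewrite mulr1 big1 ?addr0 // => m _; rewrite /oim mxE mulr0.
rewrite /ore mulr0 add0r (bigD1 m) //= big1 ?addr0 => [|m' ne].
  by rewrite {2}/oim mxE !eqxx mulr1.
by rewrite {2}/oim mxE eqxx (negbTE ne) mulr0.
Qed.

Lemma onorm_base k : onorm (obase k) = 1.
Proof.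
case: k => [[]|m] /=; rewrite /onorm.
  by rewrite expr1n big1 ?addr0 // => m _; rewrite /oim mxE expr0n.
rewrite /ore expr0n add0r (bigD1 m) //= big1 ?addr0 => [|m' ne].
  by rewrite /oim mxE !eqxx expr1n.
by rewrite /oim mxE eqxx (negbTE ne) expr0n.
Qed.

Lemma oform_inj x y : 2%:R != 0 :> K -> (forall z, oform x z = oform y z) -> x = y.
Proof.
move=> two_neq0 xy; apply: oct_eq_coord => k; apply: (mulfI two_neq0).
by rewrite -!oform_base.
Qed.

Lemma oformDl x y z : oform (x + y) z = oform x z + oform y z.
Proof. by have := oformPl 1 x y z; rewrite scale1r mul1r. Qed.

Lemma oformDr x y z : oform z (x + y) = oform z x + oform z y.
Proof. by rewrite !(oformC z) oformDl. Qed.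

Lemma oform0l z : oform 0 z = 0.
Proof. by apply: (@addrI _ (oform 0 z)); rewrite -oformDl !addr0. Qed.

Lemma oformZl k x z : oform (k *: x) z = k * oform x z.
Proof. by have := oformPl k x 0 z; rewrite oform0l !addr0. Qed.

Lemma oformZr k x z : oform z (k *: x) = k * oform z x.
Proof. by rewrite !(oformC z) oformZl. Qed.

Lemma oformNl x z : oform (- x) z = - oform x z.
Proof. by rewrite -scaleN1r oformZl mulN1r. Qed.

Lemma oformNr x z : oform z (- x) = - oform z x.
Proof. by rewrite !(oformC z) oformNl. Qed.

Lemma oform_conj x y : oform (oconj x) (oconj y) = oform x y.
Proof. by rewrite /oform -oconjD !onorm_conj. Qed.

(** Multiplicativity of the norm, polarized in the right factor; [oform_exchange] polarizes the left
    factor as well. *)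
Lemma oform_mul_same x y z : oform (omul x y) (omul x z) = onorm x * oform y z.
Proof. by rewrite /oform -omulDr !onormM; ring. Qed.

Lemma oform_mul_samer x y z : oform (omul x z) (omul y z) = oform x y * onorm z.
Proof. by rewrite /oform -omulDl !onormM; ring. Qed.

Lemma oform_exchange (a b c d : oct K) :
  oform (omul a b) (omul c d) + oform (omul a d) (omul c b)
  = oform a c * oform b d.
Proof.
have := oform_mul_same (a + c) b d.
rewrite !omulDl !oformDl !oformDr !oform_mul_same => h.
rewrite [oform a c]/oform !mulrBl -h (oformC (omul a d)); ring.
Qed.

Lemma omul1 x : omul x (oscal 1) = x.
Proof.
apply: oct_eq => [|m].
  rewrite ore_mul big1 ?subr0 => [|m _]; first exact: mulr1.
  by rewrite [oim (oscal 1) m]mxE mulr0.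
rewrite oim_mul /oscal /oim /= !mxE; rewrite /ore /=; ring.
Qed.

Lemma oconjE x : oconj x = oform x (oscal 1) *: oscal 1 - x.
Proof.
have -> : oform x (oscal 1) = 2%:R * ore x.
  rewrite oformE big1 ?addr0 => [|m _]; last by rewrite [oim (oscal 1) m]mxE mulr0.
  by rewrite [ore (oscal 1)]/(1) mulr1.
apply: oct_eq => [|m].
  rewrite ore_conj oreD oreN oreZ -[ore (oscal 1)]/(1 : K).
  by move: (ore x) => k; ring.
by rewrite oim_conj octE oimN oimZ [oim (oscal 1) m]mxE mulr0 add0r.
Qed.

(** This is [oform_exchange] with [d = 1], since [(y : 1) 1 - y] is the conjugate of [y]. *)
Lemma oform_mul x y z : oform (omul x y) z = oform x (omul z (oconj y)).
Proof.
have := oform_exchange x y z (oscal 1); rewrite !omul1 => /(canRL (addrK _)) ->.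
by rewrite (oconjE y) omulDr omulNr omulZr omul1 oformDr oformNr oformZr mulrC.
Qed.

Lemma oform_mull x y z : oform (omul x y) z = oform y (omul (oconj x) z).
Proof. by rewrite -oform_conj oconj_mul oform_mul -oform_conj oconj_mul !oconjK. Qed.

Hypothesis two_neq0 : 2%:R != 0 :> K.

(** Paired with [z], the left side becomes [(x y : z y)] by adjointness, and the polarized norm
    identity applies. *)
Lemma omul_cancelr x y : omul (omul x y) (oconj y) = onorm y *: x.
Proof.
apply: (oform_inj two_neq0) => z; rewrite oform_mul oconjK oformZl.
by rewrite oform_mul_samer mulrC.
Qed.

Lemma omul_cancell x y : omul x (omul (oconj x) y) = onorm x *: y.
Proof.
apply: (can_inj (@oconjK K)).
by rewrite oconj_mul (oconj_mul (oconj x)) oconjK omul_cancelr oconjZ.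
Qed.

(* The middle Moufang identity, in the form given by the norm. *)
Lemma omul_middle x y z : omul (omul x y) (omul z x) =
  oform x (oconj (omul y z)) *: x - onorm x *: oconj (omul y z).
Proof.
apply: (oform_inj two_neq0) => w.
rewrite (oform_mul (omul x y)) (oconj_mul z x).
(* The fourth argument is chosen so that its product with [x] collapses to [onorm x] times the
   conjugate of [z]. *)
have := oform_exchange x y w (omul (oconj x) (oconj z)).
rewrite omul_cancell => /(canRL (addrK _)) ->.
rewrite oformDl oformNl !oformZl (oconj_mul y z) -oform_mull -oform_mul mulrC.
by congr (_ - _ * _); rewrite oformC (oform_mul w) oformC.
Qed.

End OctonionIdentities.

(** * The cubic form of Hermitian matrices *)

Lemma addI3E (i : 'I_3) : (i + 1 + 1 = i + 2%:R) * (i + 1 + 2%:R = i)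
  * (i + 2%:R + 1 = i) * (i + 2%:R + 2%:R = i + 1).
Proof. by split; [split; [split|]|]; apply: val_inj; case: i => [[|[|[|]]]]. Qed.

Lemma I3_cases (i j : 'I_3) : [\/ j = i, j = i + 1 | j = i + 2%:R].
Proof.
have : [|| j == i, j == i + 1 | j == i + 2%:R].
  by case: i j => [[|[|[|//]]] ?] [[|[|[|//]]] ?].
by case/or3P=> /eqP; [constructor 1 | constructor 2 | constructor 3].
Qed.

Lemma eqI3E (i : 'I_3) : ((i + 1 == i) = false) * ((i + 2%:R == i) = false)
  * ((i == i + 1) = false) * ((i == i + 2%:R) = false)
  * ((i + 1 == i + 2%:R) = false) * ((i + 2%:R == i + 1) = false).
Proof. by case: i => [[|[|[|]]]]. Qed.

Section HermitianIdentities.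
Variable K : fieldType.
Implicit Types a b c : H3 K.

Lemma sum3 (F : 'I_3 -> K) i : \sum_j F j = F i + F (i + 1) + F (i + 2%:R).
Proof.
pose G n := F (inord n); have FE j : F j = G j by rewrite /G inord_val.
rewrite !big_ord_recl big_ord0 addr0 !FE.
case: i => [[|[|[|//]]] i3].
- by change (G 0%N + (G 1%N + G 2%N) = G 0%N + G 1%N + G 2%N); ring.
- by change (G 0%N + (G 1%N + G 2%N) = G 1%N + G 2%N + G 0%N); ring.
- by change (G 0%N + (G 1%N + G 2%N) = G 2%N + G 0%N + G 1%N); ring.
Qed.

Lemma H3_formC a b : H3_form a b = H3_form b a.
Proof.
rewrite /H3_form; congr (_ + _); apply: eq_bigr => i _.
  exact: mulrC.
exact: oformC.
Qed.

(** The trace of [(x y) z], the octonionic term of the determinant. *)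
Definition otri (x y z : oct K) : K := oform (oconj (omul x y)) z.

Lemma otriE x y z : oform (oconj (omul x y)) z = otri x y z.
Proof. by []. Qed.

Lemma otri_rot x y z : otri x y z = otri y z x.
Proof.
rewrite /otri -[RHS]oform_conj oconjK oform_mul.
by rewrite oconj_mul oform_mul oconjK -oform_conj oconjK oconj_mul.
Qed.

Lemma H3_form_cross a b c : H3_form (H3_cross a b) c = H3_form a (H3_cross b c).
Proof.
move: (hdiag_cross a b) (hoff_cross a b) (hdiag_cross b c) (hoff_cross b c).
move: (H3_cross a b) (H3_cross b c) => ab bc dab fab dbc fbc.
rewrite /H3_form !(sum3 _ 0).
rewrite !dab !dbc !fab !fbc.
rewrite !addI3E.
rewrite !add0r.
rewrite !(oformDl, oformDr, oformNl, oformNr, oformZl, oformZr).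
rewrite ![oform (hoff a _) (oconj _)]oformC. rewrite !otriE.
(* All [otri] terms are rotated to the index order 0, 1, 2; both sides are then the same
   polynomial. *)
rewrite ![otri (hoff _ 1) (hoff _ 2%:R) _]otri_rot.
rewrite ![otri (hoff _ 2%:R) (hoff _ 0) _]otri_rot.
ring.
Qed.


Hypothesis two_neq0 : 2%:R != 0 :> K.

Lemma oform_same (x : oct K) : oform x x = 2%:R * onorm x.
Proof.
by rewrite oformE.
Qed.

(** The determinant, read from a starting index so that entries at [i] can be compared without
    splitting on [i]; [H3_norm_rot] removes the choice. *)
Definition H3_norm a i : K :=
  hdiag a i * hdiag a (i + 1) * hdiag a (i + 2%:R)
  - (hdiag a i * onorm (hoff a i) + hdiag a (i + 1) * onorm (hoff a (i + 1))
     + hdiag a (i + 2%:R) * onorm (hoff a (i + 2%:R)))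
  + otri (hoff a i) (hoff a (i + 1)) (hoff a (i + 2%:R)).

Lemma H3_norm_rot a i j : H3_norm a i = H3_norm a j.
Proof.
have next k : H3_norm a (k + 1) = H3_norm a k.
  by rewrite /H3_norm !addI3E -(otri_rot (hoff a k)); ring.
suff to0 k : H3_norm a k = H3_norm a 0 by rewrite !to0.
have [->|[->|->]] : k = 0 \/ k = 0 + 1 \/ k = 0 + 1 + 1.
  by case: k => [[|[|[|//]]] ?]; [left|right;left|right;right]; apply: val_inj.
- by [].
- exact: next.
- by rewrite !next.
Qed.

Lemma onormD (x y : oct K) : onorm (x + y) = onorm x + oform x y + onorm y.
Proof. by rewrite /oform; ring. Qed.

Lemma onormN (x : oct K) : onorm (- x) = onorm x.
Proof.
by rewrite /onorm oreN sqrrN; congr (_ + _); apply: eq_bigr => m _; rewrite oimN sqrrN.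
Qed.

Lemma onormZ k (x : oct K) : onorm (k *: x) = k ^+ 2 * onorm x.
Proof.
rewrite /onorm oreZ mulrDr mulr_sumr exprMn; congr (_ + _).
by apply: eq_bigr => m _; rewrite oimZ exprMn.
Qed.

(** Diagonal entries use that the octonion norm is multiplicative. Off the diagonal, the product of
    two entries of [a^#] expands into terms settled by the middle Moufang identity and the two
    cancellation laws. *)
Lemma H3_sharp_sharp a : H3_sharp (H3_sharp a) = H3_norm a 0 *: a.
Proof.
have := hdiag_sharp a; have := hoff_sharp a.
have := hdiag_sharp (H3_sharp a); have := hoff_sharp (H3_sharp a).
move: (H3_sharp (H3_sharp a)) (H3_sharp a) => aa b faa daa fb db.
apply: H3_eq => i; rewrite ?hdiagZ ?hoffZ -(H3_norm_rot a i 0) /H3_norm.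
  rewrite daa !db fb !addI3E onormD onormN oformNr onormZ oformZr.
  by rewrite onorm_conj onormM otriE -(otri_rot (hoff a i)); ring.
rewrite faa !fb db !addI3E.
move: (hoff a i) (hoff a (i + 1)) (hoff a (i + 2%:R)) => x y z.
move: (hdiag a i) (hdiag a (i + 1)) (hdiag a (i + 2%:R)) => k l m.
have zzx : omul (oconj z) (omul z x) = onorm z *: x.
  by rewrite -{2}(oconjK z) (omul_cancell two_neq0) onorm_conj.
rewrite oconj_mul !oconjD !oconjN !oconjZ !oconjK.
rewrite !(omulDl, omulDr, omulNl, omulNr, omulZl, omulZr).
rewrite (omul_middle two_neq0) (omul_cancelr two_neq0) zzx -oconj_mul.
rewrite oformC otriE -otri_rot; apply: (oform_inj two_neq0) => w.
by rewrite !(oformDl, oformNl, oformZl); ring.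
Qed.

Lemma H3_cross_same a : H3_cross a a = 2%:R *: H3_sharp a.
Proof.
have := hdiag_cross a a; have := hoff_cross a a.
have := hdiag_sharp a; have := hoff_sharp a.
move: (H3_cross a a) (H3_sharp a) => aa b fb db faa daa.
apply: H3_eq => i; rewrite ?hdiagZ ?hoffZ.
  by rewrite daa db oform_same; ring.
rewrite faa fb; apply: (oform_inj two_neq0) => w.
by rewrite !(oformDl, oformNl, oformZl); ring.
Qed.

Lemma H3_form_sharp a : H3_form (H3_sharp a) a = 3%:R * H3_norm a 0.
Proof.
have := hdiag_sharp a; have := hoff_sharp a.
move: (H3_sharp a) => b fb db; rewrite /H3_form !(sum3 _ 0) !db !fb.
rewrite !(oformDl, oformNl, oformZl) !oform_same /H3_norm !addI3E !otriE.
rewrite -(otri_rot (hoff a 0)) (otri_rot (hoff a (0 + 2%:R))); ring.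
Qed.

Lemma hdiag0 i : hdiag (0 : H3 K) i = 0. Proof. exact: ffunE. Qed.
Lemma hoff0 i : hoff (0 : H3 K) i = 0. Proof. exact: ffunE. Qed.

Lemma oconj0 : oconj (0 : oct K) = 0.
Proof. by apply: oct_eq => [|m]; rewrite ?oim_conj /oim ?mxE ?oppr0. Qed.

Lemma onorm0 : onorm (0 : oct K) = 0.
Proof. by rewrite -(scale0r (0 : oct K)) onormZ expr0n mul0r. Qed.

Lemma H3_sharpZ k a : H3_sharp (k *: a) = k ^+ 2 *: H3_sharp a.
Proof.
have := hdiag_sharp a; have := hoff_sharp a.
have := hdiag_sharp (k *: a); have := hoff_sharp (k *: a).
move: (H3_sharp (k *: a)) (H3_sharp a) => b c fb db fc dc.
apply: H3_eq => i; rewrite ?hdiagZ ?hoffZ.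
  by rewrite db dc !hdiagZ !hoffZ onormZ; ring.
rewrite fb fc !hdiagZ !hoffZ omulZl omulZr !oconjZ; apply: (oform_inj two_neq0) => w.
by rewrite !(oformDl, oformNl, oformZl); ring.
Qed.

Lemma H3_form0l a : H3_form 0 a = 0.
Proof.
by have := H3_formPl 1 0 0 a; rewrite scale1r addr0 mul1r -[LHS]addr0 => /addrI.
Qed.

(** With [N] the determinant, doubling [a^#] makes the left side [8 N a], while [(H3_cross a a : a)]
    is [6 N]; hence [4 / 3]. *)
Lemma H3_cross_sharp_sharp a : 3%:R != 0 :> K ->
  H3_cross (H3_cross a a) (H3_cross a a)
  = (4%:R / 3%:R * H3_form (H3_cross a a) a) *: a.
Proof.
move=> three_neq0; rewrite (H3_cross_same (H3_cross a a)) (H3_cross_same a) H3_sharpZ.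
rewrite H3_sharp_sharp !scalerA; congr (_ *: _).
have := H3_formPl 2%:R (H3_sharp a) 0 a; rewrite H3_form0l !addr0 => ->.
by rewrite H3_form_sharp; move: (H3_norm a 0) => n; field.
Qed.

(** * Coordinates and the trace formula *)

Definition h3diag i : H3 K := ([ffun j => (j == i)%:R : K^o], 0).
Definition h3off i x : H3 K := (0, [ffun j => if j == i then x else 0]).

Lemma hdiag_h3diag i j : hdiag (h3diag i) j = (j == i)%:R.
Proof. exact: ffunE. Qed.
Lemma hoff_h3diag i j : hoff (h3diag i) j = 0.
Proof. exact: ffunE. Qed.
Lemma hdiag_h3off i x j : hdiag (h3off i x) j = 0.
Proof. exact: ffunE. Qed.
Lemma hoff_h3off i x j : hoff (h3off i x) j = if j == i then x else 0.
Proof. exact: ffunE. Qed.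

Lemma H3_sharp_h3diag i : H3_sharp (h3diag i) = 0.
Proof.
apply: H3_eq => j; rewrite ?hdiag_sharp ?hoff_sharp.
  rewrite !hdiag_h3diag hoff_h3diag hdiag0 onorm0 subr0.
  by case: (I3_cases i j) => ->; rewrite ?addI3E ?eqI3E ?eqxx ?mul0r ?mulr0.
by rewrite !hoff_h3diag hoff0 omul0l oconj0 scaler0 subr0.
Qed.

(** The element lives in a 2 by 2 block with unit diagonal and determinant [1 - onorm x = 0]. *)
Lemma H3_sharp_h3off i x : onorm x = 1 ->
  H3_sharp (h3diag (i + 1) + h3diag (i + 2%:R) + h3off i x) = 0.
Proof.
move=> x1; set u := _ + _.
have ud j : hdiag u j = (j == i + 1)%:R + (j == i + 2%:R)%:R.
  by rewrite !hdiagD !hdiag_h3diag hdiag_h3off addr0.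
have uf j : hoff u j = if j == i then x else 0.
  by rewrite !hoffD !hoff_h3diag hoff_h3off !add0r.
move: u ud uf => u ud uf.
apply: H3_eq => j; rewrite ?hdiag_sharp ?hoff_sharp.
  rewrite hdiag0 !ud uf; case: (I3_cases i j) => ->;
    rewrite ?addI3E ?eqI3E ?eqxx ?x1 ?onorm0 /=; ring.
rewrite hoff0 ud !uf; case: (I3_cases i j) => ->; rewrite ?addI3E ?eqI3E ?eqxx.
- by rewrite omul0l oconj0 addr0 scale0r subr0.
- by rewrite omul0l oconj0 scaler0 subr0.
- by rewrite omul0r oconj0 scaler0 subr0.
Qed.

Lemma H3_cross_h3diag a i :
  [/\ hdiag (H3_cross a (h3diag i)) (i + 1) = hdiag a (i + 2%:R),
      hdiag (H3_cross a (h3diag i)) (i + 2%:R) = hdiag a (i + 1) &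
      hoff (H3_cross a (h3diag i)) i = - hoff a i].
Proof.
have := hdiag_cross a (h3diag i); have := hoff_cross a (h3diag i).
move: (H3_cross _ _) => b fb db; split; rewrite ?db ?fb !hdiag_h3diag !hoff_h3diag.
- by rewrite !addI3E !eqI3E eqxx oformC oform0l /=; ring.
- by rewrite !addI3E !eqI3E eqxx oformC oform0l /=; ring.
- by rewrite omul0l omul0r oconj0 scaler0 eqxx scale1r add0r subr0 sub0r.
Qed.

(** Diagonal coefficients of [z |-> H3_cross (H3_cross a z) b], needed for its trace;
    [hoff_cross_h3off] supplies the remaining ones. *)
Lemma hdiag_cross_h3diag a b i :
  hdiag (H3_cross (H3_cross a (h3diag i)) b) i
  = hdiag a (i + 2%:R) * hdiag b (i + 2%:R) + hdiag a (i + 1) * hdiag b (i + 1)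
    + oform (hoff a i) (hoff b i).
Proof.
have [d1 d2 f] := H3_cross_h3diag a i.
move: (H3_cross a _) d1 d2 f => c d1 d2 f.
by rewrite hdiag_cross d1 d2 f oformNl; ring.
Qed.

Lemma H3_cross_h3off a i x :
  [/\ hdiag (H3_cross a (h3off i x)) i = - oform (hoff a i) x,
      hoff (H3_cross a (h3off i x)) i = - (hdiag a i *: x),
      hoff (H3_cross a (h3off i x)) (i + 1) = oconj (omul (hoff a (i + 2%:R)) x) &
      hoff (H3_cross a (h3off i x)) (i + 2%:R) = oconj (omul x (hoff a (i + 1)))].
Proof.
have := hdiag_cross a (h3off i x); have := hoff_cross a (h3off i x).
move: (H3_cross _ _) => b fb db; split; rewrite ?db ?fb !hdiag_h3off !hoff_h3off
  ?addI3E ?eqI3E ?eqxx.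
- by ring.
- by rewrite omul0l omul0r oconj0 scale0r addr0 sub0r subr0.
- by rewrite omul0l oconj0 scale0r scaler0 addr0 !subr0.
- by rewrite omul0r oconj0 scale0r scaler0 add0r !subr0.
Qed.

Lemma hoff_cross_h3off a b i x :
  oform (hoff (H3_cross (H3_cross a (h3off i x)) b) i) x
  = oform (hoff a i) x * oform (hoff b i) x + onorm x *
    (2%:R * (hdiag a i * hdiag b i) + oform (hoff a (i + 1)) (hoff b (i + 1))
     + oform (hoff a (i + 2%:R)) (hoff b (i + 2%:R))).
Proof.
have [d f0 f1 f2] := H3_cross_h3off a i x.
move: (H3_cross a _) d f0 f1 f2 => c d f0 f1 f2.
rewrite hoff_cross d f0 f1 f2 !(oformDl, oformNl, oformZl).
have -> : oform (oconj (omul (oconj (omul (hoff a (i + 2%:R)) x)) (hoff b (i + 2%:R)))) x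
    = oform (hoff a (i + 2%:R)) (hoff b (i + 2%:R)) * onorm x.
  by rewrite oconj_mul oconjK -oform_mul_samer oformC [RHS]oformC [RHS]oform_mull.
have -> : oform (oconj (omul (hoff b (i + 1)) (oconj (omul x (hoff a (i + 1)))))) x
    = oform (hoff a (i + 1)) (hoff b (i + 1)) * onorm x.
  by rewrite oconj_mul oconjK mulrC -oform_mul_same oform_mul oconjK.
by rewrite oform_same; ring.
Qed.

Lemma H3_form_h3diag i x : H3_form (h3diag i) x = hdiag x i.
Proof.
rewrite /H3_form (bigD1 i) //= hdiag_h3diag eqxx mul1r !big1 ?addr0 //.
  by move=> j _; rewrite hoff_h3diag oform0l.
by move=> j /negbTE ji; rewrite hdiag_h3diag ji mul0r.
Qed.

Lemma H3_form_h3off i (o : oct K) x : H3_form (h3off i o) x = oform o (hoff x i).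
Proof.
rewrite /H3_form addrC (bigD1 i) //= hoff_h3off eqxx !big1 ?addr0 //.
  by move=> j _; rewrite hdiag_h3off mul0r.
by move=> j /negbTE ji; rewrite hoff_h3off ji oform0l.
Qed.

Lemma H3_sum_base (z : H3 K) : z = \sum_i hdiag z i *: h3diag i
  + \sum_(p : 'I_3 * (unit + 'I_7)) ocoord (hoff z p.1) p.2 *: h3off p.1 (obase K p.2).
Proof.
have hdiag_sum (J : finType) (F : J -> H3 K) i :
    hdiag (\sum_j F j) i = \sum_j hdiag (F j) i.
  by elim/big_rec2: _ => [|j u v _ <-]; [exact: hdiag0 | exact: hdiagD].
have hoff_sum (J : finType) (F : J -> H3 K) i :
    hoff (\sum_j F j) i = \sum_j hoff (F j) i.
  by elim/big_rec2: _ => [|j u v _ <-]; [exact: hoff0 | exact: hoffD].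
apply: H3_eq => i; rewrite ?hdiagD ?hoffD ?hdiag_sum ?hoff_sum.
  rewrite (bigD1 i) //= !big1 ?addr0 => [||j /negbTE ji].
  + by rewrite hdiagZ hdiag_h3diag eqxx mulr1.
  + by move=> p _; rewrite hdiagZ hdiag_h3off mulr0.
  + by rewrite hdiagZ hdiag_h3diag eq_sym ji mulr0.
rewrite big1 ?add0r => [|j _]; last by rewrite hoffZ hoff_h3diag scaler0.
rewrite -(pair_bigA _ (fun j k => hoff (ocoord (hoff z j) k *: h3off j (obase K k)) i)) /=.
rewrite (bigD1 i) //= [X in _ + X]big1 ?addr0 => [|j /negbTE ji].
  rewrite {1}(oct_sum_base (hoff z i)); apply: eq_bigr => k _.
  by rewrite hoffZ hoff_h3off eqxx.
by rewrite big1 // => k _; rewrite hoffZ hoff_h3off eq_sym ji scaler0.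
Qed.

(** The 3 diagonal basis vectors contribute [3 h - (x : w)], the 24 others [24 h - 8 (x : w)]. *)
Lemma H3_trace_cross (f : 'End(H3 K)) (h : K) x w :
  (forall z, f z = h *: z + H3_form z w *: x - H3_cross (H3_cross x z) w) ->
  lfun_trace f = 27%:R * h - 9%:R * H3_form x w.
Proof.
move=> fE.
pose I := ('I_3 + 'I_3 * (unit + 'I_7))%type.
pose b (p : I) := match p with inl i => h3diag i | inr p => h3off p.1 (obase K p.2) end.
pose phi (p : I) (z : H3 K) :=
  match p with inl i => hdiag z i | inr p => ocoord (hoff z p.1) p.2 end.
rewrite (@lfun_trace_basis _ _ I b phi).
- rewrite big_sumType /= -(pair_bigA _ (fun i k => ocoord (hoff (f (h3off i (obase K k))) i) k)) /=.
  (* A coordinate is half the pairing with a basis octonion. The contribution of [(z : w) x] cancels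
     the first term of [hoff_cross_h3off]. *)
  have off i k : ocoord (hoff (f (h3off i (obase K k))) i) k
      = h - (hdiag x i * hdiag w i
        + 2%:R^-1 * (oform (hoff x (i + 1)) (hoff w (i + 1))
        + oform (hoff x (i + 2%:R)) (hoff w (i + 2%:R)))).
    rewrite -[LHS](mulKf two_neq0) -oform_base fE H3_form_h3off.
    have := hoff_cross_h3off x w i (obase K k).
    move: (H3_cross _ w) => c hc.
    rewrite hoffD hoffN hoffD !hoffZ hoff_h3off eqxx oformDl oformNl oformDl !oformZl hc.
    rewrite oform_same onorm_base (oformC (hoff x i)) (oformC (hoff _ i)).
    by field.
  have diag i : hdiag (f (h3diag i)) i
     = h + hdiag w i * hdiag x i
       - (hdiag x (i + 2%:R) * hdiag w (i + 2%:R)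
          + hdiag x (i + 1) * hdiag w (i + 1)
    + oform (hoff x i) (hoff w i)).
    rewrite fE H3_form_h3diag.
    have := hdiag_cross_h3diag x w i.
    move: (H3_cross _ w) => c hc.
    by rewrite hdiagD hdiagN hdiagD !hdiagZ hdiag_h3diag eqxx hc mulr1.
  under eq_bigr do rewrite diag.
  under [X in _ + X]eq_bigr do under eq_bigr do rewrite off.
  under [X in _ + X]eq_bigr do rewrite sumr_const card_sum card_unit card_ord.
  rewrite !(sum3 _ 0) !addI3E /H3_form !(sum3 _ 0).
  by field.
- move=> [i|[i k]] c u v /=; first by rewrite hdiagD hdiagZ.
  by rewrite hoffD hoffZ ocoord_scalar.
- by move=> z; rewrite big_sumType; exact: H3_sum_base.
Qed.

End HermitianIdentities.

(** * The matrices as a Hermitian cubic form *)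

Section HermitianInstance.
Variable R : realType.
Local Notation C := R[i].
Local Notation V := (H3 C).
Implicit Types x y z : V.

Let two_neq0 : 2%:R != 0 :> C.
Proof. by rewrite pnatr_eq0. Qed.

Lemma hdiag_bar x i : hdiag (H3_bar x) i = (hdiag x i)^*.
Proof. exact: ffunE. Qed.

Lemma hoff_bar x i : hoff (H3_bar x) i = omap (@conjc R) (hoff x i).
Proof. exact: ffunE. Qed.

Lemma ore_omap (o : oct C) : ore (omap (@conjc R) o) = (ore o)^*.
Proof. by []. Qed.

Lemma oim_omap (o : oct C) m : oim (omap (@conjc R) o) m = (oim o m)^*.
Proof. exact: mxE. Qed.

Lemma omap_conjK (o : oct C) : omap (@conjc R) (omap (@conjc R) o) = o.
Proof. by apply: oct_eq => [|m]; rewrite ?oim_omap ?ore_omap conjCK. Qed.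

Lemma omap_conjP k (o p : oct C) : omap (@conjc R) (k *: o + p)
  = k^* *: omap (@conjc R) o + omap (@conjc R) p.
Proof.
apply: oct_eq => [|m]; first by rewrite ore_omap !oreD !oreZ rmorphD rmorphM.
by rewrite oim_omap !oimD !oimZ !oim_omap rmorphD rmorphM.
Qed.

Lemma H3_barK : involutive (@H3_bar R).
Proof.
move=> x; apply: H3_eq => i; first by rewrite !hdiag_bar conjCK.
by rewrite !hoff_bar omap_conjK.
Qed.

Lemma H3_barP k x y : H3_bar (k *: x + y) = k^* *: H3_bar x + H3_bar y.
Proof.
apply: H3_eq => i.
  by rewrite hdiag_bar !hdiagD !hdiagZ !hdiag_bar rmorphD rmorphM.
by rewrite hoff_bar !hoffD !hoffZ !hoff_bar omap_conjP.
Qed.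

Lemma omap_mul (o p : oct C) : omap (@conjc R) (omul o p)
  = omul (omap (@conjc R) o) (omap (@conjc R) p).
Proof.
apply: oct_eq => [|m].
  rewrite ore_omap !ore_mul rmorphB rmorphM rmorph_sum /=; congr (_ - _).
  by apply: eq_bigr => m _; rewrite !oim_omap rmorphM.
rewrite oim_omap !oim_mul !oim_omap !ore_omap.
by rewrite !(rmorphD, rmorphM, rmorphN).
Qed.

Lemma omap_conj (o : oct C) :
  omap (@conjc R) (oconj o) = oconj (omap (@conjc R) o).
Proof. by apply: oct_eq => [|m]; rewrite // oim_omap !oim_conj oim_omap rmorphN. Qed.

Lemma oform_omap (o p : oct C) :
  oform (omap (@conjc R) o) (omap (@conjc R) p) = (oform o p)^*.
Proof.
rewrite !oformE rmorphM rmorph_nat rmorphD rmorphM rmorph_sum /=.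
congr (_ * (_ + _)); apply: eq_bigr => m _.
by rewrite !oim_omap rmorphM.
Qed.

Lemma H3_bar_cross x y :
  H3_bar (H3_cross x y) = H3_cross (H3_bar x) (H3_bar y).
Proof.
apply: H3_eq => i.
  rewrite hdiag_bar [in LHS]hdiag_cross [in RHS]hdiag_cross !hdiag_bar !hoff_bar oform_omap.
  by rewrite !(rmorphD, rmorphM, rmorphN).
rewrite hoff_bar [in LHS]hoff_cross [in RHS]hoff_cross !hdiag_bar !hoff_bar.
have omapZ k o : omap (@conjc R) (k *: o) = k^* *: omap (@conjc R) o.
  by apply: oct_eq => [|m]; rewrite ?ore_omap ?oim_omap ?oreZ ?oimZ ?ore_omap ?oim_omap rmorphM.
have omapD o p : omap (@conjc R) (o + p) = omap (@conjc R) o + omap (@conjc R) p.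
  by have := omap_conjP 1 o p; rewrite rmorph1 !scale1r.
have omapN o : omap (@conjc R) (- o) = - omap (@conjc R) o.
  by rewrite -scaleN1r omapZ rmorphN1 scaleN1r.
by rewrite -!omap_mul -!omap_conj !omapD !omapN !omapZ.
Qed.

Lemma H3_form_bar x y : H3_form (H3_bar x) (H3_bar y) = (H3_form x y)^*.
Proof.
rewrite /H3_form rmorphD !rmorph_sum /=; congr (_ + _); apply: eq_bigr => i _.
  by rewrite !hdiag_bar rmorphM.
by rewrite !hoff_bar oform_omap.
Qed.

Lemma H3_form_pos x : x <> 0 -> 0 < H3_form x (H3_bar x).
Proof.
have oE (o : oct C) : oform o (omap (@conjc R) o)
    = 2%:R * (ore o * (ore o)^* + \sum_m oim o m * (oim o m)^*).
  by rewrite oformE; congr (_ * (_ + _)); apply: eq_bigr => m _; rewrite oim_omap.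
have o_ge0 (o : oct C) : 0 <= oform o (omap (@conjc R) o).
  rewrite oE mulr_ge0 ?addr_ge0 ?mul_conjC_ge0 ?sumr_ge0 // => m _.
  exact: mul_conjC_ge0.
have o_eq0 (o : oct C) : oform o (omap (@conjc R) o) = 0 -> o = 0.
  rewrite oE => /eqP; rewrite mulf_eq0 (negbTE two_neq0) /=.
  rewrite paddr_eq0 ?mul_conjC_ge0 ?sumr_ge0 // => [|m _]; last exact: mul_conjC_ge0.
  rewrite mul_conjC_eq0 psumr_eq0 => [/andP[/eqP o0 /allP om]|m _]; last exact: mul_conjC_ge0.
  apply: oct_eq => [//|m]; have := om m (mem_index_enum _).
  by rewrite /= mul_conjC_eq0 => /eqP ->; rewrite /oim mxE.
have formE : H3_form x (H3_bar x) = \sum_i hdiag x i * (hdiag x i)^*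
    + \sum_i oform (hoff x i) (omap (@conjc R) (hoff x i)).
  by congr (_ + _); apply: eq_bigr => i _; rewrite ?hdiag_bar ?hoff_bar.
have dx i : 0 <= hdiag x i * (hdiag x i)^* by exact: mul_conjC_ge0.
move/eqP; apply: contraNT; rewrite lt_def formE negb_and addr_ge0 ?sumr_ge0 // orbF.
rewrite negbK paddr_eq0 ?sumr_ge0 // !psumr_eq0 // => /andP[/allP d0 /allP o0].
apply/eqP/H3_eq => i; rewrite ?hdiag0 ?hoff0.
  by have := d0 i (mem_index_enum _); rewrite /= mul_conjC_eq0 => /eqP.
by apply: o_eq0; apply/eqP; exact: (o0 i (mem_index_enum _)).
Qed.

(** The [h3diag] elements suffice: every entry of [x] occurs, up to sign, in some product with one
    of them. *)
Lemma H3_cross_rank1 x : x <> 0 ->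
  exists2 z, H3_cross z z = 0 & H3_cross x z <> 0.
Proof.
move=> x0; case: (pickP (fun i => H3_cross x (h3diag C i) != 0)) => [i /eqP xi|x_e].
  exists (h3diag C i) => //.
  by rewrite (H3_cross_same two_neq0) H3_sharp_h3diag scaler0.
have xe i : H3_cross x (h3diag C i) = 0 by apply/eqP; exact: (negbFE (x_e i)).
case: x0; apply: H3_eq => i; rewrite ?hdiag0 ?hoff0.
  have [] := H3_cross_h3diag x (i + 1); rewrite xe hdiag0 addI3E => <- _ _.
  by [].
have [_ _] := H3_cross_h3diag x i; rewrite xe hoff0 => /esym/eqP.
by rewrite oppr_eq0 => /eqP.
Qed.

Lemma H3_trace x y : lfun_trace (H3_D x y) = 18%:R * H3_form x (H3_bar y).
Proof.
rewrite (@H3_trace_cross _ two_neq0 _ (H3_form x (H3_bar y)) x (H3_bar y)).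
  by ring.
by move=> z; rewrite H3_DE.
Qed.

Lemma H3_hermitian_cubic :
  hermitian_cubic (@H3_cross C) (@H3_form C) (@H3_bar R) (@H3_D R).
Proof.
have crossP k x y z : H3_cross (k *: x + y) z = k *: H3_cross x z + H3_cross y z.
  by rewrite !(H3_crossC _ z) H3_cross_linearr.
split.
- exact: H3_formC.
- exact: H3_formPl.
- exact: H3_crossC.
- exact: crossP.
- exact: H3_form_cross.
- by move=> x; apply: H3_cross_sharp_sharp; rewrite pnatr_eq0.
- exact: H3_barK.
- exact: H3_barP.
- exact: H3_bar_cross.
- exact: H3_form_bar.
- exact: H3_form_pos.
- exact: H3_DE.
- exact: H3_cross_rank1.
- exists (h3diag C 0) => /(congr1 (fun a => hdiag a 0)) /eqP.
  by rewrite hdiag_h3diag hdiag0 eqxx oner_eq0.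
- exact: H3_trace.
Qed.

(** * Simplicity *)

Lemma H3_simple : simple_system (@H3_D R).
Proof.
split=> [full0|I _ idI].
  have := memvf (h3diag C 0); rewrite full0 memv0 => /eqP /(congr1 (fun a => hdiag a 0)).
  by rewrite hdiag_h3diag hdiag0 eqxx => /eqP; rewrite oner_eq0.
have [I0|I_neq0] := eqVneq I 0%VS; [by left | right].
(* Rank-one elements that detect the off-diagonal coordinates and link the diagonal units at [i + 1]
   and [i + 2]. *)
pose u i k := h3diag C (i + 1) + h3diag C (i + 2%:R) + h3off i (obase C k).
have eI x i : x \in I -> hdiag x i != 0 -> h3diag C i \in I.
  move=> xI xi; apply: (ideal_rank1 H3_hermitian_cubic idI xI).
    by rewrite (H3_cross_same two_neq0) H3_sharp_h3diag scaler0.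
  by rewrite H3_form_h3diag hdiag_bar conjC_eq0.
have u_form x i k : H3_form (u i k) (H3_bar x)
    = (hdiag x (i + 1) + hdiag x (i + 2%:R) + 2%:R * ocoord (hoff x i) k)^*.
  rewrite !rmorphD rmorphM rmorph_nat /=.
  have formD y z w : H3_form (y + z) w = H3_form y w + H3_form z w.
    by have := H3_formPl 1 y z w; rewrite scale1r mul1r.
  rewrite /u !formD !H3_form_h3diag H3_form_h3off !hdiag_bar hoff_bar oformC oform_base.
  by congr (_ + _ * _); case: k => [?|m] //=; rewrite oim_omap.
have uI x i k : x \in I ->
    hdiag x (i + 1) + hdiag x (i + 2%:R) + 2%:R * ocoord (hoff x i) k != 0 -> u i k \in I.
  move=> xI xu; apply: (ideal_rank1 H3_hermitian_cubic idI xI).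
    by rewrite (H3_cross_same two_neq0) H3_sharp_h3off ?scaler0 // onorm_base.
  by rewrite u_form conjC_eq0.
have u1 i k : hdiag (u i k) (i + 1) = 1.
  by rewrite !hdiagD !hdiag_h3diag hdiag_h3off eqxx eqI3E !addr0.
have u2 i k : hdiag (u i k) (i + 2%:R) = 1.
  by rewrite !hdiagD !hdiag_h3diag hdiag_h3off eqxx eqI3E addr0 add0r.
have [j jI] : exists j, h3diag C j \in I.
  have [x xI x0] : exists2 x, x \in I & x != 0 by exists (vpick I); rewrite ?memv_pick ?vpick0.
  case: (pickP (fun i => hdiag x i != 0)) => [i xi|xd]; first by exists i; exact: eI xi.
  have {}xd i : hdiag x i = 0 by apply/eqP/negbFE/xd.
  (* When the diagonal of [x] vanishes, a nonzero off-diagonal coordinate puts some [u i k] in the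
     ideal, and its diagonal is not zero. *)
  case: (pickP (fun p : 'I_3 * (unit + 'I_7) => ocoord (hoff x p.1) p.2 != 0)) => [[i k] /= xik|xf].
    have uikI : u i k \in I by apply: (uI x); rewrite // !xd !add0r mulf_neq0.
    by exists (i + 1); apply: (eI _ _ uikI); rewrite u1 oner_eq0.
  case/eqP: x0; rewrite (H3_sum_base x) !big1 ?addr0 // => [p _|i _].
    by rewrite (eqP (negbFE (xf p))) scale0r.
  by rewrite xd scale0r.
have uI_of i k : h3diag C (i + 1) \in I -> u i k \in I.
  move=> iI; apply: (uI _ _ _ iI); rewrite !hdiag_h3diag hoff_h3diag eqxx eqI3E.
  have -> : ocoord (0 : oct C) k = 0 by case: k => [?|m] //=; rewrite /oim mxE.
  by rewrite mulr0 !addr0 oner_eq0.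
(* Both diagonal units pair to 1 with [u i k], which therefore carries membership from one to the
   other. *)
have next i : h3diag C (i + 1) \in I -> h3diag C (i + 1 + 1) \in I.
  move=> iI; have uu := uI_of i (inl tt) iI.
  by apply: (eI _ _ uu); rewrite addI3E u2 oner_eq0.
have allI i : h3diag C i \in I.
  have j1 : h3diag C (j + 1) \in I by have := next (j + 2%:R); rewrite addI3E; apply.
  by case: (I3_cases j i) => -> //; have := next j j1; rewrite addI3E.
apply/vspaceP => z; rewrite memvf (H3_sum_base z) memvD // memv_suml // => p _.
  by rewrite memvZ.
rewrite memvZ //; have := uI_of p.1 p.2 (allI _).
have -> : h3off p.1 (obase C p.2) = u p.1 p.2 - (h3diag C (p.1 + 1) + h3diag C (p.1 + 2%:R)).
  by rewrite /u addrC addKr.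
by move=> uu; apply: memvB uu _; apply: memvD; exact: allI.
Qed.

End HermitianInstance.

Theorem theorem2p13 (R : realType) :
  simple_system (@H3_D R) /\
  tube_type (@H3_D R) /\
  is_inv_a (@H3_D R) 8 /\
  is_inv_b (@H3_D R) 0 /\
  is_rank (@H3_D R) 3 /\
  is_genus (@H3_D R) 18.
Proof.
have inv_a := hermitian_cubic_inv_a (H3_hermitian_cubic R).
have inv_b := hermitian_cubic_inv_b (H3_hermitian_cubic R).
have rank3 := hermitian_cubic_rank (H3_hermitian_cubic R).
split; first exact: H3_simple.
(* [tube_type] unfolds to [b = 0], and the genus is [2 + 8 * (3 - 1) + 0]. *)
by do !split=> //; exists 8, 0, 3.
Qed.
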